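(* Let $n \in \mathbb{N}$, $\alpha \in (0,1)$, $T > 0$, and let $V: \mathbb{R}^n \rightarrow \mathbb{R}$ satisfy the following conditions: (V.1) $V$ is convex on $\mathbb{R}^n$ and $V(0) = 0$. (V.2) $V$ is differentiable on $\mathbb{R}^n$. (V.3) For any $r \geqslant 0$, there exists $\lambda_V > 0$ such that $\|\nabla V(x) - \nabla V(y)\| \leqslant \lambda_V \|x-y\|$ for all $x, y \in B(r)$. Let $x(\cdot) \in I^\alpha(L^\infty([0,T],\mathbb{R}^n))$ and $y(t) = V(x(t))$, $t \in [0,T]$. Then $y(\cdot) \in I^\alpha(L^\infty([0,T],\mathbb{R}))$ and the inequality $$(D^\alpha y)(t) \leqslant \langle \nabla V(x(t)), (D^\alpha x)(t) \rangle$$ holds for almost every $t \in [0,T]$.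
   Context: $\mathbb{R}^k$ is the Euclidean space with scalar product $\langle\cdot,\cdot\rangle$ and norm $\|\cdot\|$; $B(r) \subset \mathbb{R}^n$ is the closed ball of radius $r$ centered at the origin; $\nabla V$ is the gradient of $V$. $[0,T]$ carries the Lebesgue measure. $L^\infty([0,T],\mathbb{R}^k)$ is the space of (classes of equivalence of) essentially bounded measurable functions $[0,T] \to \mathbb{R}^k$. Riemann-Liouville fractional integral of order $\alpha$: $(I^\alpha \varphi)(t) = \frac{1}{\Gamma(\alpha)} \int_0^t \frac{\varphi(\tau)}{(t-\tau)^{1-\alpha}} d\tau$, $t \in [0,T]$. $I^\alpha(L^\infty([0,T],\mathbb{R}^k))$ denotes the set of functions $x:[0,T] \to \mathbb{R}^k$ for which there is $\varphi(\cdot) \in L^\infty([0,T],\mathbb{R}^k)$ with $x(t) = (I^\alpha\varphi)(t)$ for all $t \in [0,T]$. Riemann-Liouville fractional derivative of order $\alpha$: $(D^\alpha x)(t) = \frac{1}{\Gamma(1-\alpha)} \frac{d}{dt} \int_0^t \frac{x(\tau)}{(t-\tau)^\alpha} d\tau$. For $x(\cdot) \in I^\alpha(L^\infty([0,T],\mathbb{R}^k))$ it is defined for almost every $t \in [0,T]$ and $(D^\alpha x)(\cdot) \in L^\infty([0,T],\mathbb{R}^k)$. *)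

(* Defs.v *)
From HB Require Import structures.
From mathcomp Require Import all_boot all_order all_algebra.
From mathcomp Require Import all_classical all_reals all_analysis.

Set Implicit Arguments.
Unset Strict Implicit.
Unset Printing Implicit Defensive.

Import Order.TTheory GRing.Theory Num.Theory.
Import numFieldNormedType.Exports.

Local Open Scope classical_set_scope.
Local Open Scope ring_scope.

(* The norm that the library puts on 'rV[R]_n is the sup norm; it induces the
   same topology, hence the same differentiability, as [enorm]. *)
Definition edot (R : realType) (n : nat) (u v : 'rV[R]_n) : R :=
  \sum_(i < n) u 0 i * v 0 i.

Definition enorm (R : realType) (n : nat) (u : 'rV[R]_n) : R :=
  Num.sqrt (edot u u).

Definition eball (R : realType) (n : nat) (r : R) : set 'rV[R]_n :=
  [set u | enorm u <= r].

Definition gradient (R : realType) (n : nat) (V : 'rV[R]_n -> R)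
    (x : 'rV[R]_n) : 'rV[R]_n :=
  \row_(i < n) 'D_(delta_mx 0 i) V x.

Definition coordf (R : realType) (n : nat) (f : R -> 'rV[R]_n) (i : 'I_n) :
  R -> R := fun t => f t 0 i.

Definition Gamma (R : realType) (a : R) : R :=
  \int[@lebesgue_measure R]_(s in `]0, +oo[) (s `^ (a - 1) * expR (- s)).

(* Functions on [0, T] are total functions on R whose values outside of [0, T]
   are ignored. The integrand below takes the value 0 at s = t, which does not
   affect the integral. *)
Definition frac_conv (R : realType) (b : R) (f : R -> R) (t : R) : R :=
  \int[@lebesgue_measure R]_(s in `[0, t]) (f s / (t - s) `^ b).

Definition RLint (R : realType) (alpha : R) (f : R -> R) (t : R) : R :=
  (Gamma alpha)^-1 * frac_conv (1 - alpha) f t.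

Definition RLint_vec (R : realType) (n : nat) (alpha : R) (f : R -> 'rV[R]_n)
    (t : R) : 'rV[R]_n :=
  \row_(i < n) RLint alpha (coordf f i) t.

(* [RLder alpha f t] is meaningful only when [RLderivable alpha f t] holds. *)
Definition RLderivable (R : realType) (alpha : R) (f : R -> R) (t : R) : Prop :=
  derivable (frac_conv alpha f) t 1.

Definition RLder (R : realType) (alpha : R) (f : R -> R) (t : R) : R :=
  (Gamma (1 - alpha))^-1 * derive1 (frac_conv alpha f) t.

Definition RLderivable_vec (R : realType) (n : nat) (alpha : R)
    (f : R -> 'rV[R]_n) (t : R) : Prop :=
  forall i : 'I_n, RLderivable alpha (coordf f i) t.

Definition RLder_vec (R : realType) (n : nat) (alpha : R) (f : R -> 'rV[R]_n)
    (t : R) : 'rV[R]_n :=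
  \row_(i < n) RLder alpha (coordf f i) t.

(* Measurability is Borel measurability: every class of L^oo has a Borel
   representative. *)
Definition Linfty (R : realType) (T : R) (phi : R -> R) : Prop :=
  measurable_fun `[0, T] phi /\
  exists M : R, {ae @lebesgue_measure R,
    forall t, `[0, T]%classic t -> `|phi t| <= M}.

Definition Linfty_vec (R : realType) (n : nat) (T : R) (phi : R -> 'rV[R]_n) :
    Prop :=
  (forall i : 'I_n, measurable_fun `[0, T] (coordf phi i)) /\
  exists M : R, {ae @lebesgue_measure R,
    forall t, `[0, T]%classic t -> enorm (phi t) <= M}.

Definition in_RLint_Linfty (R : realType) (alpha T : R) (f : R -> R) : Prop :=
  exists2 phi : R -> R, Linfty T phi &
    forall t, `[0, T]%classic t -> f t = RLint alpha phi t.

Definition in_RLint_Linfty_vec (R : realType) (n : nat) (alpha T : R)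
    (f : R -> 'rV[R]_n) : Prop :=
  exists2 phi : R -> 'rV[R]_n, Linfty_vec T phi &
    forall t, `[0, T]%classic t -> f t = RLint_vec alpha phi t.

(* Main.v *)
Require Import Defs.
From HB Require Import structures.
From mathcomp Require Import all_boot all_order all_algebra.
From mathcomp Require Import all_classical all_reals all_analysis.
From mathcomp Require Import measurable_realfun ring lra.

Set Implicit Arguments.
Unset Strict Implicit.
Unset Printing Implicit Defensive.

Import Order.TTheory GRing.Theory Num.Theory.
Import numFieldNormedType.Exports.

Local Open Scope classical_set_scope.
Local Open Scope ring_scope.

(** Write a # f for the causal convolution [vconv a f]. With h(u) = u^(alpha-1)
    and k(u) = u^(-alpha), the Riemann-Liouville integral of phi is h # phi up to
    the factor 1/Gamma(alpha), and the derivative of z is the classical derivative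
    of k # z up to the factor 1/Gamma(1-alpha). Since k # h is a constant B > 0
    ([vconv_riesz_beta]), associativity of the convolution ([vconvA], which is
    Fubini's theorem) gives k # (h # phi) = B times the primitive of phi, so that
    Lebesgue's differentiation theorem yields the derivative of h # phi almost
    everywhere ([derivable_frac_conv]). Everything thus reduces to writing
    y = h # psi with psi bounded and psi <= <grad V(x), phi>, where x = h # phi.

    Let R(t,s) = V(x s) - V(x t) - <grad V(x t), x s - x t>. Convexity gives
    R >= 0, the local Lipschitz bound on the gradient gives
    R(t,s) <= C |x s - x t|^2 ([gradient_remainder]), and x is Hoelder continuous of
    exponent alpha ([hoelder_vconv_riesz]), so that R(t,s) <= C' |t - s|^(2 alpha).
    The formal Marchaud representation of the fractional derivative then gives
    B psi = B <grad V(x), phi> - rho with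
      rho(t) = R(t,0) t^(-alpha)
               + alpha * (integral over [0,t] of R(t,s) (t-s)^(-1-alpha) ds),
    an absolutely convergent nonnegative expression. The Marchaud integrals of x
    and y themselves converge only conditionally, so the identity is proved with
    the kernel u^(-1-alpha) regularized to (u+e)^(-1-alpha); write
    q_e(u) = alpha (u+e)^(-1-alpha).

    The explicit identity q_e # h = e^(-alpha) h - P_e, where
    P_e(u) = e^(1-alpha) u^(alpha-1) / (u+e) ([vconv_marchaud_riesz]), turns the
    regularized Marchaud operator applied to x into P_e # phi, and P_e is an
    approximate identity of total mass B. Convolving the regularized identity for
    y with h gives
      P_e # y = h # <grad V(x), P_e # phi> - h # rho_e.
    Let e tend to 0. The left side tends to B y because y is Hoelder continuous
    ([vconv_approx_delta_cvg]). Multiplication by the Hoelder continuous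
    grad V(x) commutes with P_e # up to a uniformly small error
    ([vconv_approx_delta_commutator]), and h # (P_e # f) = P_e # (h # f) with
    h # f Hoelder continuous, so the first term on the right tends to
    B (h # <grad V(x), phi>). Finally rho_e increases to a bounded
    limit rho >= 0. Hence y = h # psi with psi = <grad V(x), phi> - rho / B
    ([vconv_riesz_chain]). *)

(** * Affine reflection of Lebesgue integrals *)

Section integration.
Context {R : realType}.
Notation mu := (@lebesgue_measure R).

Lemma le_Rintegrable (D : set R) (f g : R -> R) : measurable D ->
  measurable_fun D f -> (forall t, D t -> `|f t| <= g t) ->
  mu.-integrable D (EFin \o g) -> mu.-integrable D (EFin \o f).
Proof.
move=> mD mf fg; apply: le_integrable => //; first exact/measurable_EFinP.
move=> t Dt /=; rewrite lee_fin (le_trans (fg _ Dt))//; exact: ler_norm.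
Qed.

Lemma Rintegrable_bounded (D : set R) (f : R -> R) (M : R) : measurable D ->
  (mu D < +oo)%E -> measurable_fun D f -> (forall t, D t -> `|f t| <= M) ->
  mu.-integrable D (EFin \o f).
Proof.
move=> mD D_fin mf fM; apply: measurable_bounded_integrable => //.
exists M; split; first exact: num_real.
by move=> x Mx t Dt /=; rewrite (le_trans (fM _ Dt))// ltW.
Qed.


Let refl (c : R) : R -> measurableTypeR R := fun x => c - x.

Let measurable_refl (c : R) : measurable_fun [set: measurableTypeR R] (refl c).
Proof. exact: (@measurable_funB _ R R setT). Qed.

Let pushforward_refl (c : R) (A : set R) : measurable A ->
  pushforward mu (refl c) A = mu A.
Proof.
move=> mA; have mr := measurable_refl c.
apply/esym/lebesgue_measure_unique => //= _ [[a b]] _ <-.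
rewrite /pushforward/=.
have -> : refl c @^-1` `]a, b]%classic = `[c - b, c - a[%classic.
  by apply/seteqP; split => x /=; rewrite /refl !in_itv/=; lra.
rewrite !lebesgue_measure_itv/= !lte_fin ltrD2l ltrN2.
by case: ifP => // _; rewrite -!EFinD; congr EFin; ring.
Qed.

(** The reflection x -> c - x preserves Lebesgue measure, as is seen on
    half-open intervals. Translations are composites of two reflections, so
    every change of variables in a convolution reduces to this one. *)
Lemma ge0_integral_reflect (c : R) (D : set R) (f : R -> \bar R) :
  measurable D -> measurable_fun setT f -> (forall x, 0 <= f x)%E ->
  (\int[mu]_(x in ((fun x => c - x)%R @^-1` D)) f (c - x)%R = \int[mu]_(x in D) f x)%E.
Proof.
move=> mD mf f0; have mr := measurable_refl c.
transitivity (\int[pushforward mu (refl c)]_(x in D) f x)%E.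
  by rewrite (ge0_integral_pushforward mr)//; exact: measurable_funS mf.
by apply: eq_measure_integral => //= A mA AS; exact: pushforward_refl.
Qed.

Lemma integral_reflect (c : R) (D : set R) (f : R -> \bar R) :
  measurable D -> measurable_fun setT f ->
  (\int[mu]_(x in ((fun x => c - x)%R @^-1` D)) f (c - x)%R = \int[mu]_(x in D) f x)%E.
Proof.
move=> mD mf; rewrite integralE [RHS]integralE.
congr (_ - _)%E.
  rewrite -[RHS](ge0_integral_reflect c mD (measurable_funepos mf))//.
  by apply: eq_integral => x _; rewrite !funeposE.
rewrite -[RHS](ge0_integral_reflect c mD (measurable_funeneg mf))//.
by apply: eq_integral => x _; rewrite !funenegE.
Qed.

Lemma preimage_reflect_itv (c a b : R) :
  (fun x => c - x) @^-1` `[a, b] = `[c - b, c - a]%classic.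
Proof. by apply/seteqP; split => x /=; rewrite !in_itv/=; lra. Qed.

Lemma Rintegral_reflect (c a b : R) (f : R -> R) : measurable_fun setT f ->
  \int[mu]_(x in `[a, b]) f (c - x) = \int[mu]_(x in `[c - b, c - a]) f x.
Proof.
move=> mf; have mf' : measurable_fun setT (EFin \o f) by exact/measurable_EFinP.
rewrite /Rintegral -(integral_reflect c _ mf')//.
by rewrite preimage_reflect_itv !subKr.
Qed.

Lemma Rintegrable_reflect (c a b : R) (f : R -> R) : measurable_fun setT f ->
  mu.-integrable `[c - b, c - a] (EFin \o f) ->
  mu.-integrable `[a, b] (EFin \o (fun x => f (c - x))).
Proof.
move=> mf /integrableP[_ if_fin]; have mr := measurable_refl c.
apply/integrableP; split.
  apply/measurable_EFinP; apply: (measurableT_comp mf).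
  exact: measurable_funS mr.
have mabs : measurable_fun setT (abse \o (EFin \o f)).
  by apply: measurableT_comp => //; exact/measurable_EFinP.
have := @integral_reflect c `[c - b, c - a] _ _ mabs.
by rewrite preimage_reflect_itv !subKr => ->.
Qed.

End integration.

(** * Fubini and linearity for real-valued integrals *)

Section fubini.
Context {R : realType}.
Notation mu := (@lebesgue_measure R).

(** [Rintegral] is the finite part of an extended integral, so the inner
    integrals on the right only make sense for almost every r. Truncating F to D
    and E reduces the statement to Fubini's theorem on the plane, and the
    exceptional null set is absorbed there. *)
Lemma Rintegral_fubini (D E : set R) (F : R -> R -> R) (g : R -> R) :
  measurable D -> measurable E ->
  measurable_fun setT (fun z : R * R => F z.1 z.2) ->
  mu.-integrable D (EFin \o g) ->
  (forall s, D s -> mu.-integrable E (EFin \o F s)) ->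
  (forall s, D s -> \int[mu]_(r in E) `|F s r| <= g s) ->
  \int[mu]_(s in D) (\int[mu]_(r in E) F s r) =
  \int[mu]_(r in E) (\int[mu]_(s in D) F s r).
Proof.
move=> mD mE mF gint Fint Fg.
pose H (z : R * R) : \bar R := (\1_D z.1 * \1_E z.2 * F z.1 z.2)%:E.
have mH : measurable_fun setT H.
  apply/measurable_EFinP; apply: measurable_funM => //.
  by apply: measurable_funM; apply: measurableT_comp.
have HE s r : H (s, r) = ((((F s) \_ E) r) * \1_D s)%:E.
  rewrite /H/= patchE /= !indicE; case: ifPn => rE.
    by rewrite mulr1 mulrC.
  by rewrite mulr0 !mul0r.
have HE' s r : H (s, r) = ((((F ^~ r) \_ D) s) * \1_E r)%:E.
  by rewrite /H/= patchE /= !indicE; case: ifPn => rE; rewrite ?mul1r ?mul0r // mulrC.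
have inner s : D s -> (\int[mu]_r H (s, r) = (\int[mu]_(r in E) F s r)%:E)%E.
  move=> Ds; rewrite /Rintegral fineK ?integrable_fin_num//; last exact: Fint.
  rewrite [RHS]integral_mkcond; apply: eq_integral => r _.
  by rewrite HE indicE mem_set// mulr1 restrict_EFin.
have inner0 s : ~ D s -> (\int[mu]_r H (s, r) = 0)%E.
  by move=> Ds; rewrite integral0_eq// => r _; rewrite HE indicE memNset// mulr0.
have Hint : (mu \x mu)%E.-integrable setT H.
  apply/integrable12ltyP => //.
  have ggD : mu.-integrable setT ((EFin \o g) \_ D).
    by apply/(integrable_mkcond _ _).1.
  move/integrableP : ggD => [mg]; apply: le_lt_trans.
  apply: ge0_le_integral => //.
  - by move=> s _; apply: integral_ge0 => r _; exact: abse_ge0.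
  - have mabs : measurable_fun setT (abse \o H) by exact: measurableT_comp.
    by apply: (@measurable_fun_fubini_tonelli_F _ _ _ _ R mu _ mabs) => z /=.
  - exact: measurableT_comp.
  move=> s _; rewrite patchE; case: ifPn => [/set_mem Ds|].
    apply: (@le_trans _ _ ((\int[mu]_(r in E) `|F s r|)%:E)).
      rewrite /Rintegral fineK; last first.
        apply: integrable_fin_num => //.
        exact: (integrable_norm (Fint _ Ds)).
      rewrite [leRHS]integral_mkcond le_eqVlt; apply/orP; left; apply/eqP.
      apply: eq_integral => r _; rewrite HE indicE mem_set// mulr1 !patchE.
      by case: ifPn => //=; rewrite normr0.
    rewrite /= lee_fin (le_trans (Fg _ Ds))//; exact: ler_norm.
  move=> /negP Ds; rewrite integral0_eq ?abse0// => r _.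
  rewrite HE indicE memNset ?mulr0 ?abse0//.
  by move=> Ds'; apply: Ds; exact/mem_set.
have FF := Fubini Hint.
transitivity (fine (\int[mu]_s \int[mu]_r H (s, r)))%E.
  rewrite /Rintegral; congr fine; rewrite integral_mkcond.
  apply: eq_integral => s _; rewrite patchE; case: ifPn => [/set_mem Ds|/negP Ds].
    by rewrite inner.
  by rewrite inner0// => Ds'; apply: Ds; exact/mem_set.
rewrite FF /Rintegral; congr fine; rewrite [RHS]integral_mkcond.
have outer r : ((EFin \o (fun r => \int[mu]_(s in D) F s r)) \_ E) r =
    (fine (fubini_G mu H r))%:E.
  rewrite /fubini_G patchE/=; case: ifPn => [/set_mem Er|/negP Er].
    congr (_%:E); rewrite /Rintegral; congr fine; rewrite integral_mkcond.
    by apply: eq_integral => s _; rewrite HE' indicE mem_set// mulr1 restrict_EFin.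
  rewrite integral0_eq// => s _; rewrite HE' indicE memNset ?mulr0//.
  by move=> Er'; apply: Er; exact/mem_set.
have mG : measurable_fun setT (fubini_G mu H) := measurable_fubini_G Hint.
apply: ae_eq_integral => //.
  apply: (@eq_measurable_fun _ _ _ _ _ (fun r => (fine (fubini_G mu H r))%:E)).
    by move=> r _; rewrite -outer.
  by apply/measurable_EFinP; exact: measurableT_comp.
have := ae_integrable2 Hint; apply: filterS => r /= Hr_int _.
by rewrite outer /fubini_G fineK// integrable_fin_num.
Qed.

End fubini.

Section scaling.
Context {R : realType}.
Notation mu := (@lebesgue_measure R).

Lemma RintegrableZl (D : set R) (k : R) (f : R -> R) : measurable D ->
  mu.-integrable D (EFin \o f) -> mu.-integrable D (EFin \o (fun x => k * f x)).
Proof. by move=> mD fi; exact: (@integrableZl _ _ _ mu D mD k _ fi). Qed.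

Lemma RintegrableD (D : set R) (f g : R -> R) : measurable D ->
  mu.-integrable D (EFin \o f) -> mu.-integrable D (EFin \o g) ->
  mu.-integrable D (EFin \o (fun x => f x + g x)).
Proof. by move=> mD fi gi; exact: (@integrableD _ _ _ mu D mD _ _ fi gi). Qed.

Lemma RintegrableB (D : set R) (f g : R -> R) : measurable D ->
  mu.-integrable D (EFin \o f) -> mu.-integrable D (EFin \o g) ->
  mu.-integrable D (EFin \o (fun x => f x - g x)).
Proof. by move=> mD fi gi; exact: (@integrableB _ _ _ mu D mD _ _ fi gi). Qed.

(** This holds also when f is not integrable: for k nonzero, k f is then not
    integrable either, and both sides are 0, the finite part of a divergent
    integral. *)
Lemma measurable_RintegralZl (D : set R) (k : R) (f : R -> R) :
  measurable D -> measurable_fun D f ->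
  \int[mu]_(x in D) (k * f x) = k * \int[mu]_(x in D) f x.
Proof.
move=> mD mf; have [->|k0] := eqVneq k 0.
  rewrite mul0r; under eq_Rintegral do rewrite mul0r.
  by rewrite Rintegral_cst// mul0r.
have mkf : measurable_fun D (fun x => k * f x) by exact: measurable_funM.
have [fi|nfi] := boolP ((\int[mu]_(x in D) (f x)%:E)%E \is a fin_num).
  apply: RintegralZl => //; apply/integrableP; split; first exact/measurable_EFinP.
  by rewrite integral_fin_num_abs.
have nkfi : (\int[mu]_(x in D) (k * f x)%:E)%E \isn't a fin_num.
  apply: contra nfi => kfi; apply: integrable_fin_num => //.
  have : mu.-integrable D (EFin \o (fun x => k^-1 * (k * f x))).
    apply: RintegrableZl => //; apply/integrableP; split; first exact/measurable_EFinP.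
    by rewrite integral_fin_num_abs.
  by apply: eq_integrable => // x _ /=; rewrite mulKf.
have fine0 (y : \bar R) : y \isn't a fin_num -> fine y = 0.
  by case: y => //.
by rewrite /Rintegral !fine0// mulr0.
Qed.

End scaling.

(** * Causal convolution *)

Section convolution.
Context {R : realType}.
Notation mu := (@lebesgue_measure R).

(** The convolution of the extensions by 0 of a and f to the negative
    half-line. *)
Definition vconv (a f : R -> R) (t : R) : R :=
  \int[mu]_(s in `[0, t]) (a (t - s) * f s).

Lemma eq_vconv (a f g : R -> R) (t : R) :
  (forall s, 0 <= s -> s <= t -> f s = g s) -> vconv a f t = vconv a g t.
Proof.
move=> fg; apply: eq_Rintegral => s; rewrite inE/= in_itv/= => /andP[s0 st].
by rewrite fg.
Qed.

Lemma vconvC (a f : R -> R) (t : R) : measurable_fun setT a ->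
  measurable_fun setT f -> vconv a f t = vconv f a t.
Proof.
move=> ma mf.
have mg : measurable_fun setT (fun s : R => a (t - s) * f s).
  apply: measurable_funM => //; apply: measurableT_comp => //.
  exact: measurable_funB.
have := Rintegral_reflect t 0 t mg; rewrite subr0 subrr /vconv => <-.
by apply: eq_Rintegral => s _; rewrite subKr mulrC.
Qed.

Lemma vconv_t0 (a f : R -> R) (t : R) : t <= 0 -> vconv a f t = 0.
Proof.
rewrite le_eqVlt => /predU1P[->|t0]; rewrite /vconv.
  by rewrite set_itv1 Rintegral_set1.
by rewrite set_itv_ge ?Rintegral_set0//= bnd_simp -ltNge.
Qed.

(** The value at t is the finite part of the difference of two integrals of
    nonnegative functions jointly measurable in s and t, and Tonelli's theorem
    gives the measurability of each of them, finite or not. *)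
Lemma measurable_vconv (a f : R -> R) : measurable_fun setT a ->
  measurable_fun setT f -> measurable_fun setT (vconv a f).
Proof.
move=> ma mf.
pose A : set (R * R) := ([set z | 0 <= z.2] `&` [set z | z.2 <= z.1]).
have mA : measurable A.
  apply: measurableI; rewrite -[X in measurable X]setTI.
    exact: measurable_fun_le.
  exact: measurable_fun_le.
pose G (z : R * R) : \bar R := (\1_A z * (a (z.1 - z.2) * f z.2))%:E.
have mG : measurable_fun setT G.
  apply/measurable_EFinP; apply: measurable_funM; first exact: measurable_indic.
  apply: measurable_funM; last exact: measurableT_comp.
  apply: measurableT_comp => //; exact: measurable_funB.
have mGp : measurable_fun setT (fubini_F mu (G^\+)%E).
  by apply: (@measurable_fun_fubini_tonelli_F _ _ _ _ R mu _ (measurable_funepos mG)).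
have mGn : measurable_fun setT (fubini_F mu (G^\-)%E).
  by apply: (@measurable_fun_fubini_tonelli_F _ _ _ _ R mu _ (measurable_funeneg mG)).
have -> : vconv a f = fine \o (fubini_F mu (G^\+)%E \- fubini_F mu (G^\-)%E)%E.
  apply/funext => t; rewrite /vconv Rintegral_mkcond /Rintegral /=; congr fine.
  rewrite integralE /fubini_F; congr (_ - _)%E; apply: eq_integral => s _.
    rewrite !funeposE /G patchE indicE; case: ifPn => [/set_mem|/negP] /=.
      by rewrite in_itv/= => /andP[s0 st]; rewrite mem_set ?mul1r.
    move=> nI; rewrite memNset ?mul0r// => -[/= s0 st]; apply: nI.
    by rewrite inE/= in_itv/= s0.
  rewrite !funenegE /G patchE indicE; case: ifPn => [/set_mem|/negP] /=.
    by rewrite in_itv/= => /andP[s0 st]; rewrite mem_set ?mul1r.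
  move=> nI; rewrite memNset ?mul0r// => -[/= s0 st]; apply: nI.
  by rewrite inE/= in_itv/= s0.
apply: measurableT_comp => //; exact: emeasurable_funB.
Qed.

End convolution.

Section convolution_algebra.
Context {R : realType} (T : R).
Notation mu := (@lebesgue_measure R).

Definition vkernel (a : R -> R) := [/\ measurable_fun setT a,
  forall u, 0 <= a u & mu.-integrable `[0, T] (EFin \o a)].

(** Measurability is required on the whole line and boundedness only on [0, T]:
    this class is stable under convolution with a kernel, whereas a bound
    outside of [0, T] would be lost. *)
Definition mbounded (f : R -> R) := measurable_fun setT f /\
  exists M : R, forall t, 0 <= t -> t <= T -> `|f t| <= M.

Lemma sub_itv0 (t : R) : t <= T -> `[0, t]%classic `<=` `[0, T].
Proof. by move=> tT; apply: subset_itvl; rewrite bnd_simp. Qed.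

Lemma vkernel_integrable (a : R -> R) (t : R) : vkernel a -> t <= T ->
  mu.-integrable `[0, t] (EFin \o a).
Proof. by move=> [_ _ ai] tT; apply: integrableS ai => //; exact: sub_itv0. Qed.

Lemma vkernel_reflect_integrable (a : R -> R) (s t : R) : vkernel a ->
  0 <= s -> t <= T ->
  mu.-integrable `[s, t] (EFin \o (fun r => a (t - r))).
Proof.
move=> ka s0 tT; apply: Rintegrable_reflect; first by case: ka.
rewrite subrr; apply: vkernel_integrable => //; lra.
Qed.

Lemma vkernel_mass_le (a : R -> R) (s t : R) : vkernel a -> s <= t -> t <= T ->
  \int[mu]_(r in `[0, s]) a r <= \int[mu]_(r in `[0, t]) a r.
Proof.
move=> ka st tT; have [ma a0 _] := ka.
have fin u : u <= T -> (\int[mu]_(r in `[0%R, u]) (a r)%:E)%E \is a fin_num.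
  by move=> uT; apply: integrable_fin_num => //; exact: (vkernel_integrable ka).
rewrite /Rintegral fine_le ?fin ?(le_trans st)//.
apply: ge0_subset_integral => //.
- by apply: measurable_funS (measurable_int _ (vkernel_integrable ka tT)) => //.
- by move=> r _; rewrite lee_fin.
- by apply: subset_itvl; rewrite bnd_simp.
Qed.

Lemma mbounded_ge0 (f : R -> R) : mbounded f ->
  exists2 M : R, 0 <= M & forall t, 0 <= t -> t <= T -> `|f t| <= M.
Proof.
move=> [_ [M fM]]; exists `|M| => // t t0 tT.
by rewrite (le_trans (fM _ t0 tT))// ler_norm.
Qed.

Lemma vconv_integrable (a f : R -> R) (t : R) : vkernel a -> mbounded f ->
  t <= T -> mu.-integrable `[0, t] (EFin \o (fun s => a (t - s) * f s)).
Proof.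
move=> ka bf tT; have [ma a0 _] := ka.
have [M M0 fM] := mbounded_ge0 bf.
apply: (@le_Rintegrable _ _ _ (fun s => M * a (t - s))) => //.
- apply: measurable_funTS; apply: measurable_funM; last by case: bf.
  by apply: measurableT_comp => //; exact: measurable_funB.
- move=> s /=; rewrite in_itv/= => /andP[s0 st].
  rewrite normrM (ger0_norm (a0 _)) mulrC ler_wpM2r// fM//.
  exact: le_trans tT.
- by apply: RintegrableZl => //; exact: vkernel_reflect_integrable.
Qed.

Lemma vconv_cst1 (a : R -> R) (t : R) : vkernel a -> t <= T ->
  vconv a (cst 1) t = \int[mu]_(s in `[0, t]) a s.
Proof.
move=> [ma _ _] tT; have := Rintegral_reflect t 0 t ma.
rewrite subrr subr0 /vconv => <-.
by apply: eq_Rintegral => s _; rewrite mulr1.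
Qed.

Lemma normr_vconv_le (a f : R -> R) (M t : R) : vkernel a -> mbounded f ->
  t <= T -> (forall s, 0 <= s -> s <= t -> `|f s| <= M) ->
  `|vconv a f t| <= M * \int[mu]_(s in `[0, t]) a s.
Proof.
move=> ka bf tT fM; have [ma a0 _] := ka.
have int_af := vconv_integrable ka bf tT.
apply: (le_trans (le_normr_Rintegral _ int_af)) => //.
have := Rintegral_reflect t 0 t ma; rewrite subrr subr0 => <-.
have int_ar := vkernel_reflect_integrable ka (lexx 0) tT.
rewrite -(RintegralZl _ _ int_ar)//; apply: le_Rintegral => //.
- exact: integrable_norm int_af.
- exact: RintegrableZl.
- move=> s /=; rewrite in_itv/= => /andP[s0 st].
  by rewrite normrM (ger0_norm (a0 _)) mulrC ler_wpM2r// fM.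
Qed.

Lemma mbounded_vconv (a f : R -> R) : vkernel a -> mbounded f ->
  mbounded (vconv a f).
Proof.
move=> ka bf; have [ma a0 _] := ka; have [mf _] := bf; split.
  exact: measurable_vconv.
have [M M0 fM] := mbounded_ge0 bf.
exists (M * \int[mu]_(s in `[0, T]) a s) => t t0 tT.
have := @normr_vconv_le a f M t ka bf tT (fun s s0 st => fM _ s0 (le_trans st tT)).
move=> /le_trans; apply; apply: ler_wpM2l => //; exact: vkernel_mass_le.
Qed.

Lemma mboundedD (f g : R -> R) : mbounded f -> mbounded g ->
  mbounded (fun t => f t + g t).
Proof.
move=> [mf [M fM]] [mg [N gN]]; split; first exact: measurable_funD.
exists (M + N) => t t0 tT; rewrite (le_trans (ler_normD _ _))// lerD//.
  exact: fM.
exact: gN.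
Qed.

Lemma mboundedM (f g : R -> R) : mbounded f -> mbounded g ->
  mbounded (fun t => f t * g t).
Proof.
move=> [mf [M fM]] [mg [N gN]]; split; first exact: measurable_funM.
exists (M * N) => t t0 tT; rewrite normrM ler_pM//.
  exact: fM.
exact: gN.
Qed.

Lemma mbounded_cst (c : R) : mbounded (cst c).
Proof. by split => //; exists `|c|. Qed.

Lemma mboundedZ (c : R) (f : R -> R) : mbounded f -> mbounded (fun t => c * f t).
Proof. by move=> bf; apply: mboundedM => //; exact: mbounded_cst. Qed.

Lemma mboundedB (f g : R -> R) : mbounded f -> mbounded g ->
  mbounded (fun t => f t - g t).
Proof.
move=> bf /(mboundedZ (-1)) bg; have := mboundedD bf bg.
by under eq_fun do rewrite mulN1r.
Qed.

Lemma mbounded_sum (n : nat) (f : 'I_n -> R -> R) : (forall i, mbounded (f i)) ->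
  mbounded (fun t => \sum_(i < n) f i t).
Proof.
move=> bf; elim: (index_enum _) => [|i s IH].
  by under eq_fun do rewrite big_nil; exact: mbounded_cst.
by under eq_fun do rewrite big_cons; exact: mboundedD.
Qed.

Lemma vconvD (a f g : R -> R) (t : R) : vkernel a -> mbounded f -> mbounded g ->
  t <= T -> vconv a (fun s => f s + g s) t = vconv a f t + vconv a g t.
Proof.
move=> ka bf bg tT; rewrite -RintegralD//; [|exact: vconv_integrable..].
by apply: eq_Rintegral => s _; rewrite mulrDr.
Qed.

Lemma vconvZ (a f : R -> R) (c t : R) : vkernel a -> mbounded f -> t <= T ->
  vconv a (fun s => c * f s) t = c * vconv a f t.
Proof.
move=> ka bf tT; rewrite -RintegralZl//; last exact: vconv_integrable.
by apply: eq_Rintegral => s _; rewrite mulrCA.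
Qed.

Lemma vconvB (a f g : R -> R) (t : R) : vkernel a -> mbounded f -> mbounded g ->
  t <= T -> vconv a (fun s => f s - g s) t = vconv a f t - vconv a g t.
Proof.
move=> ka bf bg tT; rewrite -RintegralB//; [|exact: vconv_integrable..].
by apply: eq_Rintegral => s _; rewrite mulrBr.
Qed.

Lemma vconv_sum (n : nat) (a : R -> R) (f : 'I_n -> R -> R) (t : R) : vkernel a ->
  (forall i, mbounded (f i)) -> t <= T ->
  vconv a (fun s => \sum_(i < n) f i s) t = \sum_(i < n) vconv a (f i) t.
Proof.
move=> ka bf tT; elim: (index_enum _) => [|i s IH].
  rewrite big_nil -[RHS](mul0r (vconv a (cst 0) t)) -(vconvZ _ _ (mbounded_cst 0))//.
  by apply: eq_vconv => r _ _; rewrite big_nil mul0r.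
rewrite big_cons -IH -vconvD//; first by apply: eq_vconv => r _ _; rewrite big_cons.
elim: s {IH} => [|j s IH].
  by under eq_fun do rewrite big_nil; exact: mbounded_cst.
by under eq_fun do rewrite big_cons; exact: mboundedD.
Qed.

(** Both sides are iterated integrals of a(t-s) b(s-r) f(r) over the triangle 0
    <= r <= s <= t. The inner integral over s is the value at t - r of the
    convolution of a and b, after the reflection s -> t - s. *)
Lemma vconvA (a b f : R -> R) (t : R) : vkernel a -> vkernel b -> mbounded f ->
  t <= T -> vconv a (vconv b f) t = vconv (vconv a b) f t.
Proof.
move=> ka kb bf tT; have [ma a0 _] := ka; have [mb b0 _] := kb.
have [mf _] := bf; have [M M0 fM] := mbounded_ge0 bf.
pose A : set (R * R) := [set z | z.2 <= z.1].
have mA : measurable A.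
  by rewrite -[X in measurable X]setTI; exact: measurable_fun_le.
(* The integrand is cut off above the diagonal, so that both variables range over
   the whole of [0, t]. *)
pose F (s r : R) := a (t - s) * (\1_A (s, r) * (b (s - r) * f r)).
have mF : measurable_fun setT (fun z : R * R => F z.1 z.2).
  apply: measurable_funM; first by apply: measurableT_comp => //; exact: measurable_funB.
  apply: measurable_funM.
    rewrite (_ : (fun _ => _) = \1_A); first exact: measurable_indic.
    by apply/funext => -[].
  by apply: measurable_funM; apply: measurableT_comp => //; exact: measurable_funB.
have AE (s r : R) : \1_A (s, r) = (r <= s)%R%:R :> R.
  rewrite indicE; congr (_ %:R); congr nat_of_bool.
  by apply/idP/idP => [/set_mem//|rs]; exact/mem_set.
have FE (s : R) : s <= t -> {in `[0, t]%classic,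
    F s =1 (fun r => a (t - s) * ((fun r => b (s - r) * f r) \_ `[0, s]) r)}.
  move=> st r; rewrite inE/= in_itv/= => /andP[r0 rt].
  rewrite /F AE patchE mem_setE in_itv/= r0/=.
  by case: ifP => _; rewrite ?mul1r ?mul0r.
have itvE (s : R) : s <= t -> `[0, t] `&` `[0, s]%classic = `[0, s]%classic.
  move=> st; apply/setIidPr; apply: subset_itvl; rewrite bnd_simp//.
have int_restr (s : R) (h : R -> R) : s <= t ->
    mu.-integrable `[0, s] (EFin \o h) ->
    mu.-integrable `[0, t] (EFin \o (h \_ `[0, s])).
  move=> st hi; rewrite -restrict_EFin.
  by apply/integrable_restrict => //=; rewrite itvE.
transitivity (\int[mu]_(s in `[0, t]) (\int[mu]_(r in `[0, t]) F s r)).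
  apply: eq_Rintegral => s; rewrite inE/= in_itv/= => /andP[s0 st].
  rewrite [X in _ = X](_ : _ = \int[mu]_(r in `[0, t])
    (a (t - s) * ((fun r => b (s - r) * f r) \_ `[0, s]) r)); last first.
    by apply: eq_Rintegral => r rt; rewrite FE.
  rewrite measurable_RintegralZl//; last first.
    apply: measurable_funTS; apply/measurable_restrict => //; apply: measurable_funTS.
    by apply: measurable_funM => //; apply: measurableT_comp => //; exact: measurable_funB.
  by rewrite -Rintegral_mkcondr itvE.
rewrite (@Rintegral_fubini R `[0, t] `[0, t] F
    (fun s => (M * \int[mu]_(u in `[0, T]) b u) * a (t - s)))//; last 3 first.
- by apply: RintegrableZl => //; exact: vkernel_reflect_integrable.
- move=> s /=; rewrite in_itv/= => /andP[s0 st].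
  apply: (@eq_integrable _ _ _ mu `[0, t] _ (EFin \o _)).
  + by [].
  + by move=> r rt; rewrite /= FE//.
  apply: RintegrableZl => //; apply: int_restr => //.
  by apply: vconv_integrable => //; exact: le_trans tT.
- move=> s /=; rewrite in_itv/= => /andP[s0 st].
  have sT := le_trans st tT.
  rewrite mulrC; under eq_Rintegral => r rt do rewrite FE// normrM (ger0_norm (a0 _)).
  have bnf : mbounded (fun r => `|f r|).
    split; first exact: measurableT_comp.
    by exists M => r r0 rT; rewrite normr_id fM.
  have int_bf := vconv_integrable kb bnf sT.
  rewrite [leLHS](_ : _ = \int[mu]_(r in `[0, t])
    (a (t - s) * ((fun r => b (s - r) * `|f r|) \_ `[0, s]) r)); last first.
    apply: eq_Rintegral => r _; rewrite !patchE; case: ifPn => //=; last by rewrite normr0.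
    by rewrite normrM (ger0_norm (b0 _)).
  rewrite RintegralZl//; last exact: int_restr.
  apply: ler_wpM2l => //; rewrite -Rintegral_mkcondr itvE//.
  apply: (le_trans (ler_norm _)).
  apply: (le_trans (@normr_vconv_le b _ M s kb bnf sT _)).
    by move=> r r0 rs; rewrite normr_id fM// (le_trans rs).
  by apply: ler_wpM2l => //; exact: vkernel_mass_le.
apply: eq_Rintegral => r; rewrite inE/= in_itv/= => /andP[r0 rt].
have mab : measurable_fun setT (fun s : R => a (t - s) * b (s - r)).
  by apply: measurable_funM; apply: measurableT_comp => //; exact: measurable_funB.
transitivity (\int[mu]_(s in `[0, t])
    (f r * ((fun s => a (t - s) * b (s - r)) \_ `[r, t]) s)).
  apply: eq_Rintegral => s; rewrite inE/= in_itv/= => /andP[s0 st].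
  rewrite /F AE patchE mem_setE in_itv/= st andbT.
  by case: ifP => _; rewrite ?mul0r ?mulr0// mul1r mulrA mulrC.
rewrite measurable_RintegralZl//; last first.
  by apply: measurable_funTS; apply/measurable_restrict => //; exact: measurable_funTS.
rewrite -Rintegral_mkcondr mulrC; congr (_ * _).
rewrite (_ : _ `&` _ = `[r, t]%classic); last first.
  by apply/setIidPr; apply: subset_itvr; rewrite bnd_simp.
have mab' : measurable_fun setT (fun w : R => a w * b (t - r - w)).
  by apply: measurable_funM => //; apply: measurableT_comp => //; exact: measurable_funB.
rewrite [RHS]vconvC// /vconv.
have := Rintegral_reflect t r t mab'; rewrite subrr => E.
rewrite [RHS](_ : _ = \int[mu]_(w in `[0, t - r]) (a w * b (t - r - w))); last first.
  by apply: eq_Rintegral => w _; rewrite mulrC.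
by rewrite -E; apply: eq_Rintegral => s _; congr (_ * b _); ring.
Qed.

End convolution_algebra.

(** * Convergence and the fundamental theorem for singular integrands *)

Section calculus.
Context {R : realType}.
Notation mu := (@lebesgue_measure R).

Lemma Rdominated_cvg (D : set R) (f_ : nat -> R -> R) (f g : R -> R) :
  measurable D -> (forall n, measurable_fun D (f_ n)) ->
  (forall s, D s -> f_ n s @[n --> \oo] --> f s) ->
  mu.-integrable D (EFin \o g) -> (forall n s, D s -> `|f_ n s| <= g s) ->
  \int[mu]_(s in D) f_ n s @[n --> \oo] --> \int[mu]_(s in D) f s.
Proof.
move=> mD mf ff gi fg.
have mf' n : measurable_fun D (EFin \o f_ n) by exact/measurable_EFinP.
have ff' s : D s -> (EFin \o f_ n) s @[n --> \oo] --> (EFin \o f) s.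
  by move=> Ds; apply: cvg_EFin; [exact: nearW|exact: ff].
have fg' n s : D s -> (`|(EFin \o f_ n) s| <= (EFin \o g) s)%E.
  by move=> Ds /=; rewrite lee_fin fg.
have mlim : measurable_fun D (EFin \o f).
  by apply/measurable_EFinP; exact: measurable_fun_cvg ff.
have [fi _ cv] := @dominated_convergence _ _ _ mu D mD
  (fun n => EFin \o f_ n) (EFin \o f) (EFin \o g) mf' mlim
  (aeW mu ff') gi (aeW mu (fun s n => fg' n s)).
apply: fine_cvg; rewrite /Rintegral fineK//; exact: integrable_fin_num.
Qed.

(** The fundamental theorem for a nonnegative integrand that may blow up at the
    left endpoint: apply the usual theorem on [a + d, b] and let d decrease to
    0, by monotone convergence. *)
Lemma Rintegral_FTC_left (f F : R -> R) (a b : R) : a < b ->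
  measurable_fun setT f ->
  (forall x, a < x -> x <= b -> 0 <= f x) ->
  (forall x, a < x -> x <= b -> is_derive x 1 F (f x)) ->
  (forall x, a < x -> x <= b -> {for x, continuous f}) ->
  F x @[x --> a^'+] --> F a ->
  mu.-integrable `[a, b] (EFin \o f) /\ \int[mu]_(x in `[a, b]) f x = F b - F a.
Proof.
move=> ab mf f0 dF cf Fa.
pose d (n : nat) := a + (b - a) / n.+2%:R.
have dgt n : a < d n by rewrite /d ltrDl divr_gt0// subr_gt0.
have dlt n : d n < b.
  rewrite /d -ltrBrDl ltr_pdivrMr ?ltr0n// ltr_pMr ?subr_gt0//.
  by rewrite ltr1n.
have dF' x : a < x -> x <= b -> {for x, continuous F}.
  move=> ax xb; apply: differentiable_continuous; apply/derivable1_diffP.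
  by have [] := dF x ax xb.
have Fd n : (\int[mu]_(x in `[d n, b]) (f x)%:E = (F b)%:E - (F (d n))%:E)%E.
  have dnx x : d n <= x -> a < x by move=> h; rewrite (lt_le_trans (dgt n)).
  apply: continuous_FTC2 => //.
  - apply: continuous_in_subspaceT => x; rewrite inE/= in_itv/= => /andP[dx xb].
    by apply: cf => //; exact: dnx.
  - split.
    + move=> x; rewrite in_itv/= => /andP[dx xb].
      by have [] := dF x (dnx _ (ltW dx)) (ltW xb).
    + by apply: cvg_at_right_filter; apply: dF' => //; exact: ltW.
    + by apply: cvg_at_left_filter; apply: dF'.
  - move=> x; rewrite in_itv/= => /andP[dx xb].
    by rewrite derive1E; have [_ ->] := dF x (dnx _ (ltW dx)) (ltW xb).
have dcvg : d n @[n --> \oo] --> a.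
  rewrite /d -[X in _ --> X]addr0 -[X in _ --> _ + X](mulr0 (b - a)).
  apply: cvgD; first exact: cvg_cst.
  apply: cvgM; first exact: cvg_cst.
  have := @cvg_harmonic R; rewrite -(cvg_shiftS (@harmonic R)).
  by apply.
have Fdcvg : F (d n) @[n --> \oo] --> F a.
  have := (cvg_at_rightP F a (F a)).1 Fa; apply; split => //.
have bigE : \bigcup_n `[d n, b]%classic = `]a, b]%classic.
  apply/seteqP; split => x /=.
    by move=> [n _] /=; rewrite !in_itv/= => /andP[dx ->]; rewrite (lt_le_trans (dgt n)).
  rewrite in_itv/= => /andP[ax xb].
  have [n _ dn] : \forall n \near \oo, d n < x by exact: (cvgr_lt a).
  by exists n => //=; rewrite in_itv/= xb andbT ltW//; apply: dn => /=.
have mfE (A : set R) : measurable A -> measurable_fun A (EFin \o f).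
  by move=> mA; apply/measurable_EFinP; exact: measurable_funTS.
have nd : nondecreasing_seq (fun n => `[d n, b]%classic).
  move=> m n mn; apply/subsetPset; apply: subset_itvr; rewrite bnd_simp.
  rewrite /d lerD2l ler_pM2l ?subr_gt0// lef_pV2 ?posrE ?ltr0n//.
  by rewrite ler_nat !ltnS.
have f0' n x : `[d n, b]%classic x -> (0 <= (EFin \o f) x)%E.
  rewrite /= in_itv/= => /andP[dx xb]; rewrite lee_fin f0//.
  by rewrite (lt_le_trans (dgt n)).
have lim1 : (\int[mu]_(x in `[d n, b]) (EFin \o f) x)%E @[n --> \oo] -->
    (\int[mu]_(x in \bigcup_n `[d n, b]%classic) (EFin \o f) x)%E.
  apply: ge0_nondecreasing_set_cvg_integral => //.
  by move=> n; exact: mfE.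
have lim2 : (\int[mu]_(x in `[d n, b]) (EFin \o f) x)%E @[n --> \oo] --> ((F b - F a)%:E).
  under eq_fun do rewrite Fd -EFinB.
  by apply: cvg_EFin; [exact: nearW|apply: cvgB => //; exact: cvg_cst].
have E : (\int[mu]_(x in `[a, b]) (f x)%:E)%E = (F b - F a)%:E.
  rewrite -integral_itv_obnd_cbnd; last exact: mfE.
  rewrite -bigE; exact: (cvg_unique _ lim1 lim2).
split; last by rewrite /Rintegral E.
apply/integrableP; split; first exact: mfE.
rewrite (_ : (fun _ => _) = (EFin \o (fun x => `|f x|))) //.
rewrite -integral_itv_obnd_cbnd; last first.
  by apply/measurable_EFinP; apply: measurableT_comp => //; exact: measurable_funTS.
rewrite [ltLHS](_ : _ = \int[mu]_(x in `]a, b]) (f x)%:E)%E; last first.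
  apply: eq_integral => x; rewrite inE/= in_itv/= => /andP[ax xb].
  by rewrite ger0_norm// f0.
rewrite integral_itv_obnd_cbnd; last exact: mfE.
by rewrite E ltry.
Qed.

End calculus.

(** * Power kernels and the regularized kernels *)

Section power_kernels.
Context {R : realType}.
Notation mu := (@lebesgue_measure R).
Implicit Types (p al e u t T : R).

Lemma ler_powR_nonpos (r x y : R) : r <= 0 -> 0 < x -> x <= y ->
  y `^ r <= x `^ r.
Proof.
move=> r0 x0 xy; have y0 := lt_le_trans x0 xy.
rewrite -(opprK r) !(powRN _ (- r)) lef_pV2 ?posrE ?powR_gt0//.
by apply: ge0_ler_powR; rewrite ?nnegrE ?oppr_ge0// ltW.
Qed.

Lemma continuous_powR_gt0 (r x : R) : 0 < x -> {for x, continuous (fun u => u `^ r)}.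
Proof.
move=> x0; apply: differentiable_continuous; apply/derivable1_diffP.
by have [] := is_derive1_powR r x0.
Qed.

(** Up to the factor 1 / Gamma(p), the kernel of the Riemann-Liouville integral
    of order p; the kernel u^(-al) of the derivative of order al is [riesz (1 -
    al)]. *)
Definition riesz (p : R) : R -> R := fun u => u `^ (p - 1).

Lemma measurable_riesz p : measurable_fun setT (riesz p).
Proof. exact: measurable_powR. Qed.

Lemma riesz_integral p t : 0 < p -> 0 <= t ->
  mu.-integrable `[0, t] (EFin \o riesz p) /\
  \int[mu]_(u in `[0, t]) riesz p u = t `^ p / p.
Proof.
move=> p0; rewrite le_eqVlt => /predU1P[<-|t0].
  rewrite set_itv1 Rintegral_set1 powR0 ?gt_eqF// mul0r; split => //.
  apply: (@Rintegrable_bounded _ _ _ (riesz p 0)) => //.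
  - by rewrite lebesgue_measure_set1 ltry.
  - by apply: measurable_funTS; exact: measurable_riesz.
  - by move=> u ->; rewrite ger0_norm// powR_ge0.
have H := @Rintegral_FTC_left R (riesz p) (fun u => p^-1 * u `^ p) 0 t t0
  (measurable_riesz p).
have [] := H.
- by move=> x _ _; exact: powR_ge0.
- move=> x x0 _; have D := is_derive1_powR p x0.
  have -> : riesz p x = p^-1 *: (p * x `^ (p - 1)).
    by rewrite /riesz [RHS]mulKf// gt_eqF.
  exact: is_deriveZ.
- by move=> x x0 _; exact: continuous_powR_gt0.
- rewrite powR0 ?gt_eqF//; apply: cvgM; first exact: cvg_cst.
  exact: powR_cvg0.
move=> ri ->; split => //.
by rewrite powR0 ?gt_eqF// mulr0 subr0 mulrC.
Qed.

Lemma vkernel_riesz T p : 0 < p -> 0 <= T -> vkernel T (riesz p).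
Proof.
move=> p0 T0; split; [exact: measurable_riesz|move=> u; exact: powR_ge0|].
by have [] := riesz_integral p0 T0.
Qed.

Definition shifted_power r e : R -> R := fun u => (u + e) `^ r.

Lemma measurable_shifted_power r e : measurable_fun setT (shifted_power r e).
Proof.
apply: (measurableT_comp (@measurable_powR R r)).
exact: measurable_funD.
Qed.

Lemma shifted_power_bound r e u : r <= 0 -> 0 < e -> 0 <= u ->
  shifted_power r e u <= e `^ r.
Proof. by move=> r0 e0 u0; apply: ler_powR_nonpos => //; rewrite lerDr. Qed.

Lemma vkernel_shifted_power T r e : r <= 0 -> 0 < e -> vkernel T (shifted_power r e).
Proof.
move=> r0 e0; split; [exact: measurable_shifted_power|move=> u; exact: powR_ge0|].
apply: (@Rintegrable_bounded _ _ _ (e `^ r)) => //.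
- by rewrite lebesgue_measure_itv/=; case: ifP => // _; rewrite -EFinB ltry.
- apply: measurable_funTS; exact: measurable_shifted_power.
- move=> u /=; rewrite in_itv/= => /andP[u0 _].
  rewrite ger0_norm ?powR_ge0//; exact: shifted_power_bound.
Qed.

(** Minus the derivative of the regularized kernel (u + e)^(-al). For e = 0 this
    is the non-integrable kernel of the Marchaud derivative. *)
Definition marchaud al e : R -> R := fun u => al * shifted_power (- al - 1) e u.

Lemma measurable_marchaud al e : measurable_fun setT (marchaud al e).
Proof. by apply: measurable_funM => //; exact: measurable_shifted_power. Qed.

Lemma vkernel_marchaud T al e : 0 < al -> 0 < e -> vkernel T (marchaud al e).
Proof.
move=> al0 e0; split; first exact: measurable_marchaud.
- by move=> u; rewrite mulr_ge0 ?powR_ge0// ltW.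
- have r0 : - al - 1 <= 0 by lra.
  by apply: RintegrableZl => //; have [] := vkernel_shifted_power T r0 e0.
Qed.

Lemma is_derive_shifted_power (r e u : R) : 0 < u + e ->
  is_derive u 1 (shifted_power r e) (r * shifted_power (r - 1) e u).
Proof.
move=> ue0.
have D1 : is_derive u 1 (fun v : R => v + e) 1.
  by rewrite -[X in is_derive _ _ _ X]addr0; apply: is_deriveD.
have D := @is_derive1_comp R (fun v => v `^ r) (fun v : R => v + e) u _ _
  (is_derive1_powR r ue0) D1.
by rewrite mulr1 in D.
Qed.

Lemma marchaud_integral al e t : 0 < al -> 0 < e -> 0 <= t ->
  \int[mu]_(u in `[0, t]) marchaud al e u = e `^ (- al) - (t + e) `^ (- al).
Proof.
move=> al0 e0; rewrite le_eqVlt => /predU1P[<-|t0].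
  by rewrite set_itv1 Rintegral_set1 add0r subrr.
have pos u : 0 <= u -> 0 < u + e by move=> u0; lra.
have H := @Rintegral_FTC_left R (marchaud al e) (fun u => - shifted_power (- al) e u) 0 t t0
  (measurable_marchaud al e).
have [] := H.
- by move=> x _ _; rewrite mulr_ge0 ?powR_ge0// ltW.
- move=> x x0 _; have -> : marchaud al e x = - ((- al) * shifted_power (- al - 1) e x).
    by rewrite /marchaud; ring.
  apply: is_deriveN; apply: is_derive_shifted_power; exact: pos (ltW x0).
- move=> x x0 _; apply: cvgM; first exact: cvg_cst.
  apply: differentiable_continuous; apply/derivable1_diffP.
  by have [] := is_derive_shifted_power (- al - 1) (pos x (ltW x0)).
- apply: cvg_at_right_filter; apply: cvgN.
  apply: differentiable_continuous; apply/derivable1_diffP.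
  by have [] := is_derive_shifted_power (- al) (pos 0 (lexx 0)).
by move=> _ ->; rewrite /shifted_power add0r; ring.
Qed.

(** The function e^(1-al) u^(al-1) / (u + e). The exponent -1 is a real power so
    that the kernel is nonnegative on the whole line. *)
Definition approx_delta al e : R -> R :=
  fun u => e `^ (1 - al) * riesz al u * shifted_power (- 1) e u.

Lemma measurable_approx_delta al e : measurable_fun setT (approx_delta al e).
Proof.
apply: measurable_funM; last exact: measurable_shifted_power.
by apply: measurable_funM => //; exact: measurable_riesz.
Qed.

Lemma approx_delta_ge0 al e u : 0 <= approx_delta al e u.
Proof. by rewrite !mulr_ge0 ?powR_ge0. Qed.

Lemma vkernel_approx_delta T al e : 0 < al -> 0 < e -> 0 <= T -> vkernel T (approx_delta al e).
Proof.
move=> al0 e0 T0; split; [exact: measurable_approx_delta|move=> u; exact: approx_delta_ge0|].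
have [mr r0 ri] := vkernel_riesz al0 T0.
apply: (@le_Rintegrable _ _ _ (fun u => (e `^ (1 - al) * e `^ (- 1)) * riesz al u)) => //.
- by apply: measurable_funTS; exact: measurable_approx_delta.
- move=> u /=; rewrite in_itv/= => /andP[u0 _].
  rewrite ger0_norm ?approx_delta_ge0// /approx_delta mulrAC ler_wpM2r//.
  by rewrite ler_wpM2l ?powR_ge0// shifted_power_bound.
- exact: RintegrableZl.
Qed.

(** The integrand al (A-v)^(-al-1) v^(al-1), with A = u + e, has the explicit
    primitive v^al (A-v)^(-al) / A. The left side is thus e^(-al) u^al / (u +
    e), and u = (u + e) - e splits it into the two terms on the right. *)
Lemma vconv_marchaud_riesz al e u : 0 < al -> al < 1 -> 0 < e -> 0 <= u ->
  vconv (marchaud al e) (riesz al) u = e `^ (- al) * riesz al u - approx_delta al e u.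
Proof.
move=> al0 al1 e0; rewrite le_eqVlt => /predU1P[<-|u0].
  rewrite vconv_t0// /approx_delta /riesz powR0 ?mulr0 ?mul0r ?subrr//.
  by rewrite subr_eq0 lt_eqF.
pose A := u + e; have A0 : 0 < A by rewrite addr_gt0.
pose G (v : R) := v `^ al * shifted_power (- al) e (u - v).
have pos v : v <= u -> 0 < u - v + e by move=> vu; lra.
have Dshift v : v <= u ->
    is_derive v 1 (fun w => shifted_power (- al) e (u - w)) (marchaud al e (u - v)).
  move=> vu.
  have D1 : is_derive v 1 (fun w : R => u - w) (- 1).
    by rewrite -[X in is_derive _ _ _ X]add0r; apply: is_deriveB.
  have D := @is_derive1_comp R (shifted_power (- al) e) (fun w : R => u - w) v _ _
    (is_derive_shifted_power (- al) (pos v vu)) D1.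
  have -> // : marchaud al e (u - v) = - al * shifted_power (- al - 1) e (u - v) * - 1.
  by rewrite /marchaud; ring.
have H := @Rintegral_FTC_left R (fun v => marchaud al e (u - v) * riesz al v)
  (fun v => A^-1 * G v) 0 u u0.
rewrite /vconv; have [] := H.
- apply: measurable_funM; last exact: measurable_riesz.
  by apply: (measurableT_comp (measurable_marchaud al e)); exact: measurable_funB.
- by move=> v _ _; rewrite !mulr_ge0 ?powR_ge0// ltW.
- move=> v v0 vu.
  have D := is_deriveM (is_derive1_powR al v0) (Dshift v vu).
  have DZ := is_deriveZ A^-1 D.
  apply: (is_derive_eq DZ).
  rewrite /= /marchaud /shifted_power /riesz /GRing.scale/=.
  have vE : v `^ al = v * v `^ (al - 1) by rewrite mulr_powRB1// ltW.
  have wE : (u - v + e) `^ (- al) = (u - v + e) * (u - v + e) `^ (- al - 1).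
    have w0 := pos v vu.
    rewrite -{2}(powRr1 (ltW w0)) -powRD; last by apply/implyP => _; rewrite gt_eqF.
    by congr (_ `^ _); ring.
  by rewrite vE wE /A; field; rewrite gt_eqF.
- move=> v v0 vu; apply: cvgM; last exact: continuous_powR_gt0.
  apply: cvgM; first exact: cvg_cst.
  apply: (@continuous_comp _ _ _ (fun w => u - w) (shifted_power (- al - 1) e)).
    by apply: cvgB; [exact: cvg_cst|exact: cvg_id].
  apply: differentiable_continuous; apply/derivable1_diffP.
  by have [] := is_derive_shifted_power (- al - 1) (pos v vu).
- apply: cvgM; first exact: cvg_cst.
  have cS : {for 0, continuous (fun w => shifted_power (- al) e (u - w))}.
    apply: differentiable_continuous; apply/derivable1_diffP.
    by have [] := Dshift 0 (ltW u0).
  apply: cvgM; last exact: (cvg_at_right_filter cS).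
  by rewrite powR0 ?gt_eqF//; exact: powR_cvg0.
move=> _ ->; rewrite /G subrr powR0 ?gt_eqF// mul0r mulr0 subr0 /approx_delta /riesz.
rewrite /shifted_power add0r (_ : u + e = A)// (powR_inv1 (ltW A0)).
have vE : u `^ al = u * u `^ (al - 1) by rewrite mulr_powRB1// ltW.
have eE : e `^ (1 - al) = e * e `^ (- al).
  rewrite -{2}(powRr1 (ltW e0)) -powRD//.
  by apply/implyP => _; rewrite gt_eqF.
rewrite vE eE /A; field; rewrite -/A gt_eqF//.
Qed.

End power_kernels.

(** * The beta constant *)

Section beta.
Context {R : realType}.
Notation mu := (@lebesgue_measure R).
Context (al : R) (al0 : 0 < al) (al1 : al < 1).
Implicit Types (e u t T : R).

Local Ltac alra := move: al0 al1 => ? ?; lra.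

(** The regularized Marchaud operator applied to a fractional integral of f is a
    mollification of f. *)
Lemma vconv_approx_delta T e (f : R -> R) t : 0 < e -> 0 <= T -> mbounded T f ->
  t <= T ->
  vconv (approx_delta al e) f t = e `^ (- al) * vconv (riesz al) f t -
                          vconv (marchaud al e) (vconv (riesz al) f) t.
Proof.
move=> e0 T0 bf tT.
have kr := vkernel_riesz al0 T0; have kq := vkernel_marchaud T al0 e0.
have mr := measurable_riesz al; have mq := measurable_marchaud al e.
rewrite (vconvA kq kr bf tT).
have kP := vkernel_approx_delta al0 e0 T0.
have iP := vconv_integrable kP bf tT.
have ir := vconv_integrable kr bf tT.
have iE := RintegrableZl (e `^ (- al)) (measurable_itv `[0, t]) ir.
rewrite /vconv -RintegralZl//.
rewrite -[X in _ = _ - X](_ : \int[mu]_(s in `[0, t])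
  (e `^ (- al) * (riesz al (t - s) * f s) - approx_delta al e (t - s) * f s) = _).
  by rewrite RintegralB// opprB addrC subrK.
apply: eq_Rintegral => s; rewrite inE/= in_itv/= => /andP[s0 st].
have ts : 0 <= t - s by rewrite subr_ge0.
by have := vconv_marchaud_riesz al0 al1 e0 ts; rewrite {1}/vconv => ->; rewrite mulrBl mulrA.
Qed.

(** Take f = 1 in [vconv_approx_delta]. The right side converges as e tends to
    0, which exhibits the mass of the approximate identity as a beta
    integral. *)
Lemma approx_delta_mass e t : 0 < e -> 0 <= t -> \int[mu]_(u in `[0, t]) approx_delta al e u =
  vconv (riesz al) (shifted_power (- al) e) t.
Proof.
move=> e0 t0.
have kr := vkernel_riesz al0 t0; have kq := vkernel_marchaud t al0 e0.
have kP := vkernel_approx_delta al0 e0 t0.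
have mr := measurable_riesz al; have mq := measurable_marchaud al e.
have b1 := mbounded_cst t (1 : R).
have bS : mbounded t (shifted_power (- al) e).
  split; first exact: measurable_shifted_power.
  exists (e `^ (- al)) => u u0 _; rewrite ger0_norm ?powR_ge0//.
  by apply: shifted_power_bound => //; rewrite oppr_le0 ltW.
rewrite -(vconv_cst1 kP (lexx t)) (vconv_approx_delta e0 t0 b1 (lexx t)).
rewrite (vconvA kq kr b1 (lexx t)).
have -> : vconv (marchaud al e) (riesz al) = vconv (riesz al) (marchaud al e).
  by apply/funext => s; exact: vconvC.
rewrite -(vconvA kr kq b1 (lexx t)).
rewrite (@eq_vconv _ _ (vconv (marchaud al e) (cst 1))
  (fun s => e `^ (- al) * cst 1 s - shifted_power (- al) e s)); last first.
  by move=> s s0 st; rewrite (vconv_cst1 kq st) marchaud_integral// mulr1.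
rewrite (@vconvB _ t)//; last exact: mboundedZ.
by rewrite (@vconvZ _ t)// opprB addrC subrK.
Qed.

Definition eps (n : nat) : R := n.+1%:R^-1.

Lemma eps_gt0 n : 0 < eps n.
Proof. by rewrite invr_gt0 ltr0n. Qed.

Lemma eps_cvg : eps n @[n --> \oo] --> 0.
Proof. exact: cvg_harmonic. Qed.

Lemma eps_powR_cvg r : 0 < r -> (eps n) `^ r @[n --> \oo] --> 0.
Proof.
move=> r0; have := powR_cvg0 r0 => /cvg_at_rightP; apply.
by split; [exact: eps_gt0|exact: eps_cvg].
Qed.

Lemma shifted_power_cvg r u : 0 < u ->
  shifted_power r (eps n) u @[n --> \oo] --> u `^ r.
Proof.
move=> u0; have ue : u + eps n @[n --> \oo] --> u.
  by rewrite -[X in _ --> X]addr0; apply: cvgD; [exact: cvg_cst|exact: eps_cvg].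
exact: (cvg_comp _ _ ue (continuous_powR_gt0 u0)).
Qed.

(** This bound is uniform in e and integrable, which is what dominated
    convergence needs in [delta_moment_cvg0]. It follows from e^(1-al) u^al <=
    (u + e)^(1-al) (u + e)^al. *)
Lemma approx_delta_moment_le e u : 0 < e -> 0 <= u ->
  approx_delta al e u * u `^ al <= riesz al u.
Proof.
move=> e0 u0; have ue : 0 < u + e by alra.
rewrite /approx_delta /shifted_power (powR_inv1 (ltW ue)).
rewrite -mulrA (mulrC (e `^ _)) -mulrA ler_piMr ?powR_ge0//.
rewrite mulrCA mulrC ler_pdivrMr ?mul1r//.
have -> : u + e = (u + e) `^ (1 - al) * (u + e) `^ al.
  rewrite -powRD ?subrK ?powRr1 ?ltW//.
  by apply/implyP => _; rewrite gt_eqF.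
apply: ler_pM; rewrite ?powR_ge0//; apply: ge0_ler_powR; rewrite ?nnegrE; alra.
Qed.

(** The error committed when an approximate identity acts on a function that is
    Hoelder continuous of exponent al and constant 1. *)
Definition delta_moment (e t : R) := \int[mu]_(u in `[0, t]) (approx_delta al e u * u `^ al).

Lemma measurable_delta_moment e : measurable_fun setT (fun u => approx_delta al e u * u `^ al).
Proof. by apply: measurable_funM; [exact: measurable_approx_delta|exact: measurable_powR]. Qed.

Lemma delta_moment_integrable e t : 0 < e -> 0 <= t ->
  mu.-integrable `[0, t] (EFin \o (fun u => approx_delta al e u * u `^ al)).
Proof.
move=> e0 t0; have [_ _ ri] := vkernel_riesz al0 t0.
apply: (@le_Rintegrable _ _ _ (riesz al)) => //.
  by apply: measurable_funTS; exact: measurable_delta_moment.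
move=> u /=; rewrite in_itv/= => /andP[u0 _].
by rewrite ger0_norm ?approx_delta_moment_le// mulr_ge0 ?approx_delta_ge0 ?powR_ge0.
Qed.

Lemma delta_moment_cvg0 t : 0 <= t -> delta_moment (eps n) t @[n --> \oo] --> 0.
Proof.
move=> t0; have [_ _ ri] := vkernel_riesz al0 t0.
rewrite [X in _ --> X](_ : 0 = \int[mu]_(u in `[0, t]) (cst 0 u)); last first.
  by rewrite Rintegral_cst// mul0r.
apply: (@Rdominated_cvg _ _ _ _ (riesz al)) => //.
- by move=> n; apply: measurable_funTS; exact: measurable_delta_moment.
- move=> u /=; rewrite in_itv/= => /andP[u0 _].
  move: u0; rewrite le_eqVlt => /predU1P[<-|u0].
    under eq_fun do rewrite powR0 ?gt_eqF// mulr0; exact: cvg_cst.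
  rewrite [X in _ --> X](_ : 0 = 0 * riesz al u * u `^ (- 1) * u `^ al); last by ring.
  apply: cvgM; last exact: cvg_cst.
  apply: cvgM; last exact: shifted_power_cvg.
  apply: cvgM; last exact: cvg_cst.
  by apply: eps_powR_cvg; rewrite subr_gt0.
- move=> n u /=; rewrite in_itv/= => /andP[u0 _].
  rewrite ger0_norm ?approx_delta_moment_le ?eps_gt0// mulr_ge0 ?approx_delta_ge0 ?powR_ge0//.
Qed.

(** On either half of [0, t] one of the two factors is bounded by its value at t
    / 2. *)
Lemma beta_integrable t : 0 < t ->
  mu.-integrable `[0, t] (EFin \o (fun s => riesz al (t - s) * riesz (1 - al) s)).
Proof.
move=> t0; have t2 : 0 < t / 2 by rewrite divr_gt0.
have kr := vkernel_riesz al0 (ltW t0).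
have kr' : vkernel t (riesz (1 - al)) by apply: vkernel_riesz; [alra|exact: ltW].
have [_ _ ri'] := kr'.
apply: (@le_Rintegrable _ _ _ (fun s => (t / 2) `^ (al - 1) * riesz (1 - al) s +
   (t / 2) `^ (- al) * riesz al (t - s))) => //.
- apply: measurable_funTS; apply: measurable_funM; last exact: measurable_riesz.
  by apply: (measurableT_comp (measurable_riesz al)); exact: measurable_funB.
- move=> s /=; rewrite in_itv/= => /andP[s0 st].
  rewrite ger0_norm ?mulr_ge0 ?powR_ge0//.
  have [st2|st2] := leP s (t / 2).
    rewrite -[leLHS]addr0 lerD ?mulr_ge0 ?powR_ge0//.
    rewrite ler_wpM2r ?powR_ge0// ler_powR_nonpos//; alra.
  rewrite -[leLHS]add0r lerD ?mulr_ge0 ?powR_ge0// mulrC.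
  rewrite ler_wpM2r ?powR_ge0// /riesz (_ : 1 - al - 1 = - al); last by ring.
  rewrite ler_powR_nonpos//; alra.
- apply: RintegrableD => //; first exact: RintegrableZl.
  by apply: RintegrableZl => //; exact: (vkernel_reflect_integrable kr).
Qed.

Lemma approx_delta_mass_cvg t : 0 < t ->
  \int[mu]_(u in `[0, t]) approx_delta al (eps n) u @[n --> \oo] -->
  vconv (riesz al) (riesz (1 - al)) t.
Proof.
move=> t0; have bi := beta_integrable t0.
have kr := vkernel_riesz al0 (ltW t0).
have sub : `]0, t]%classic `<=` `[0, t] by apply: subset_itv_oc_cc.
have bS n : mbounded t (shifted_power (- al) (eps n)).
  split; first exact: measurable_shifted_power.
  exists ((eps n) `^ (- al)) => u u0 _; rewrite ger0_norm ?powR_ge0//.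
  by apply: shifted_power_bound => //; [alra|exact: eps_gt0].
have E n : \int[mu]_(u in `[0, t]) approx_delta al (eps n) u =
    \int[mu]_(s in `]0, t]) (riesz al (t - s) * shifted_power (- al) (eps n) s).
  rewrite approx_delta_mass ?eps_gt0 ?ltW// /vconv Rintegral_itv_obnd_cbnd//.
  by apply: integrableS (vconv_integrable kr (bS n) (lexx t)).
under eq_fun do rewrite E.
rewrite /vconv -Rintegral_itv_obnd_cbnd; last exact: integrableS bi.
have mrt : measurable_fun setT (fun s : R => riesz al (t - s)).
  by apply: (measurableT_comp (measurable_riesz al)); exact: measurable_funB.
(* The origin is removed because [riesz (1 - al)] takes there the default value 0,
   which neither dominates the shifted powers nor is their limit. *)
apply: (@Rdominated_cvg _ _ _ _ (fun s => riesz al (t - s) * riesz (1 - al) s)) => //.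
- move=> n; apply: measurable_funTS; apply: measurable_funM => //.
  exact: measurable_shifted_power.
- move=> s /=; rewrite in_itv/= => /andP[s0 st].
  apply: cvgM; first exact: cvg_cst.
  rewrite /riesz (_ : 1 - al - 1 = - al); last by ring.
  exact: shifted_power_cvg.
- exact: integrableS bi.
- move=> n s /=; rewrite in_itv/= => /andP[s0 st].
  rewrite ger0_norm ?mulr_ge0 ?powR_ge0// ler_wpM2l ?powR_ge0//.
  rewrite /riesz (_ : 1 - al - 1 = - al); last by ring.
  by rewrite /shifted_power ler_powR_nonpos//; have := eps_gt0 n; alra.
Qed.

(** Homogeneity of the beta integral, obtained without a change of scale: the
    two sides are limits of the masses of the approximate identity on [0, s] and
    on [0, t], and the mass carried by ]s, t] is at most s^(-al) times the
    vanishing moment. *)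
Lemma beta_le_const s t : 0 < s -> s <= t ->
  vconv (riesz al) (riesz (1 - al)) s = vconv (riesz al) (riesz (1 - al)) t.
Proof.
move=> s0 st; have t0 := lt_le_trans s0 st.
have Ms := approx_delta_mass_cvg s0; have Mt := approx_delta_mass_cvg t0.
apply/eqP; rewrite eq_sym -subr_eq0; apply/eqP.
have cvd : \int[mu]_(u in `[0, t]) approx_delta al (eps n) u -
    \int[mu]_(u in `[0, s]) approx_delta al (eps n) u @[n --> \oo] -->
    vconv (riesz al) (riesz (1 - al)) t - vconv (riesz al) (riesz (1 - al)) s.
  exact: (cvgB Mt Ms).
apply: (cvg_unique (@Rhausdorff R) cvd).
apply: (@squeeze_cvgr _ _ _ _ (cst 0) (fun n => s `^ (- al) * delta_moment (eps n) t)).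
- apply: nearW => n /=.
  have kP := vkernel_approx_delta al0 (eps_gt0 n) (ltW t0).
  rewrite subr_ge0 (vkernel_mass_le kP)//=.
  rewrite Rintegral_itvB; [|by case: kP|by rewrite bnd_simp ltW|by rewrite bnd_simp].
  have mo := delta_moment_integrable (eps_gt0 n) (ltW t0).
  have sub : `]s, t]%classic `<=` `[0, t].
    by apply: subset_itvr; rewrite bnd_simp ltW.
  rewrite /delta_moment -RintegralZl//.
  apply: (@le_trans _ _
    (\int[mu]_(u in `]s, t]) (s `^ (- al) * (approx_delta al (eps n) u * u `^ al)))).
    apply: le_Rintegral => //.
    - by case: kP => _ _; exact: integrableS.
    - by apply: RintegrableZl => //; exact: integrableS mo.
    - move=> u /=; rewrite in_itv/= => /andP[su ut].
      rewrite mulrCA ler_peMr ?approx_delta_ge0// powRN mulrC ler_pdivlMr ?powR_gt0//.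
      by rewrite mul1r ge0_ler_powR ?nnegrE; alra.
  rewrite /Rintegral fine_le//.
  + by apply: integrable_fin_num => //; apply: RintegrableZl => //; exact: integrableS mo.
  + by apply: integrable_fin_num => //; apply: RintegrableZl.
  + apply: ge0_subset_integral => //.
      apply/measurable_EFinP; apply: measurable_funTS; apply: measurable_funM => //.
      exact: measurable_delta_moment.
    by move=> u _; rewrite lee_fin !mulr_ge0 ?powR_ge0 ?approx_delta_ge0.
- exact: cvg_cst.
- rewrite -[X in _ --> X](mulr0 (s `^ (- al))); apply: cvgM; first exact: cvg_cst.
  exact: delta_moment_cvg0 (ltW t0).
Qed.

(** The Euler beta integral B(al, 1 - al) = Gamma(al) Gamma(1 - al). *)
Definition beta_const : R := vconv (riesz al) (riesz (1 - al)) 1.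

Lemma vconv_riesz_beta t : 0 < t -> vconv (riesz al) (riesz (1 - al)) t = beta_const.
Proof.
move=> t0; have [t1|t1] := leP t 1; first exact: beta_le_const.
by apply/esym/beta_le_const; [exact: ltr01|exact: ltW].
Qed.

Lemma beta_const_gt0 : 0 < beta_const.
Proof.
have bi := beta_integrable (@ltr01 R).
have kr := vkernel_riesz al0 (@ler01 R).
have sub : `]0, 1]%classic `<=` `[(0:R), 1] by apply: subset_itv_oc_cc.
have ri := vkernel_reflect_integrable kr (lexx 0) (lexx 1).
apply: (@lt_le_trans _ _ (\int[mu]_(s in `[0, 1]) riesz al (1 - s))).
  have := Rintegral_reflect 1 0 1 (measurable_riesz al).
  rewrite subrr subr0 => ->; have [_ ->] := riesz_integral al0 (@ler01 R).
  by rewrite powR1 mul1r invr_gt0.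
rewrite /beta_const /vconv -!Rintegral_itv_obnd_cbnd; last 2 first.
  exact: integrableS bi.
  exact: integrableS ri.
apply: le_Rintegral => //.
- exact: integrableS ri.
- exact: integrableS bi.
move=> s /=; rewrite in_itv/= => /andP[s0 s1].
rewrite ler_peMr ?powR_ge0// /riesz.
have r0 : 1 - al - 1 <= 0 by alra.
by have := ler_powR_nonpos r0 s0 s1; rewrite powR1.
Qed.

End beta.

(** * Approximate identity, Hoelder regularity and differentiation *)

Lemma normr_le_cvg0 (R : realType) (f g : nat -> R) :
  (forall n, `|f n| <= g n) -> g n @[n --> \oo] --> 0 -> f n @[n --> \oo] --> 0.
Proof.
move=> fg g0; apply: (@squeeze_cvgr _ _ _ _ (fun n => - g n) g) => //.
  by apply: nearW => n; rewrite -ler_norml.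
by rewrite -oppr0; exact: cvgN.
Qed.

Section regularity.
Context {R : realType}.
Notation mu := (@lebesgue_measure R).
Context (al : R) (al0 : 0 < al) (al1 : al < 1) (T : R) (T0 : 0 < T).
Implicit Types (e s t : R) (f g z : R -> R).

Local Ltac alra := move: al0 al1 T0 => ? ? ?; lra.

(** Only ordered pairs s <= t are considered, so that no absolute value occurs
    under the power. *)
Definition hoelder_on (L : R) (z : R -> R) :=
  forall s t, 0 <= s -> s <= t -> t <= T -> `|z t - z s| <= L * (t - s) `^ al.

(** A function that vanishes at t to order al contributes to the mollification
    at t at most the moment of the kernel. *)
Lemma normr_vconv_approx_delta_le e z L t : 0 < e -> mbounded T z -> 0 <= L ->
  0 <= t -> t <= T ->
  (forall s, 0 <= s -> s <= t -> `|z s| <= L * (t - s) `^ al) ->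
  `|vconv (approx_delta al e) z t| <= L * delta_moment al e T.
Proof.
move=> e0 bz L0 t0 tT zL.
have kP := vkernel_approx_delta al0 e0 (ltW T0).
have kM : vkernel T (fun u => approx_delta al e u * u `^ al).
  split; first exact: measurable_delta_moment.
    by move=> u; rewrite mulr_ge0 ?approx_delta_ge0 ?powR_ge0.
  exact: delta_moment_integrable (ltW T0).
have iz := vconv_integrable kP bz tT.
apply: (le_trans (le_normr_Rintegral _ iz)) => //.
apply: (@le_trans _ _ (L * \int[mu]_(u in `[0, t]) (approx_delta al e u * u `^ al))); last first.
  by apply: ler_wpM2l => //; exact: (vkernel_mass_le kM).
have := Rintegral_reflect t 0 t (measurable_delta_moment al e).
rewrite subrr subr0 => <-.
have iM := vkernel_reflect_integrable kM (lexx 0) tT.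
rewrite -(RintegralZl _ _ iM)//; apply: le_Rintegral => //.
- exact: integrable_norm iz.
- exact: RintegrableZl.
- move=> s /=; rewrite in_itv/= => /andP[s0 st].
  rewrite normrM (ger0_norm (approx_delta_ge0 _ _ _)) mulrCA ler_wpM2l ?approx_delta_ge0//.
  exact: zL.
Qed.

(** Split z = (z - z(t)) + z(t): the first part is killed in the limit, the
    second one is multiplied by the mass. *)
Lemma vconv_approx_delta_cvg z L t : mbounded T z -> 0 <= L -> hoelder_on L z ->
  0 < t -> t <= T ->
  vconv (approx_delta al (eps n)) z t @[n --> \oo] --> beta_const al * z t.
Proof.
move=> bz L0 hz t0 tT.
have kP n := vkernel_approx_delta al0 (eps_gt0 n) (ltW T0).
have b1 := mbounded_cst T (1 : R).
pose d n := vconv (approx_delta al (eps n)) (fun s => z s - z t * cst 1 s) t.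
have E : (fun n => vconv (approx_delta al (eps n)) z t) =
    (fun n => d n + (\int[mu]_(u in `[0, t]) approx_delta al (eps n) u) * z t).
  apply/funext => n; rewrite /d (vconvB (kP n) bz _ tT); last exact: mboundedZ.
  by rewrite (vconvZ _ (kP n))// (vconv_cst1 (kP n))// mulrC subrK.
have d0 : d n @[n --> \oo] --> 0.
  apply: (@normr_le_cvg0 _ _ (fun n => L * delta_moment al (eps n) T)).
    move=> n; apply: normr_vconv_approx_delta_le => //; [exact: eps_gt0| |exact: ltW|].
      by apply: mboundedB => //; exact: mboundedZ.
    by move=> s s0 st; rewrite mulr1 distrC; exact: hz.
  rewrite -[X in _ --> X](mulr0 L); apply: cvgM; first exact: cvg_cst.
  by apply: delta_moment_cvg0 => //; exact: ltW.
have Bz : (\int[mu]_(u in `[0, t]) approx_delta al (eps n) u) * z t @[n --> \oo] -->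
    beta_const al * z t.
  apply: cvgM; last exact: cvg_cst.
  by rewrite -(vconv_riesz_beta al0 al1 t0); exact: approx_delta_mass_cvg.
have := cvgD d0 Bz; rewrite (add0r (beta_const al * z t)) E; exact.
Qed.

(** The difference is the convolution with (g(t) - g(s)) f(s), which vanishes at
    s = t to order al. The bound does not depend on t. *)
Lemma vconv_approx_delta_commutator e f g L M t : 0 < e -> mbounded T f -> mbounded T g ->
  0 <= L -> hoelder_on L g -> 0 <= M ->
  (forall s, 0 <= s -> s <= T -> `|f s| <= M) ->
  0 <= t -> t <= T ->
  `|g t * vconv (approx_delta al e) f t - vconv (approx_delta al e) (fun s => g s * f s) t| <=
  L * M * delta_moment al e T.
Proof.
move=> e0 bf bg L0 hg M0 fM t0 tT.
have kP := vkernel_approx_delta al0 e0 (ltW T0).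
rewrite -(vconvZ _ kP bf tT) -(vconvB kP _ _ tT)//; [|exact: mboundedZ|exact: mboundedM].
apply: normr_vconv_approx_delta_le => //; [|exact: mulr_ge0|].
  by apply: mboundedB; [exact: mboundedZ|exact: mboundedM].
move=> s s0 st; rewrite -mulrBl normrM mulrAC ler_pM//.
  exact: hg.
by apply: fM => //; exact: le_trans tT.
Qed.

(** Over [0, s] the kernel decreases when s is replaced by t, so the difference
    of kernels has a sign and its integral is explicit, as is the integral of
    the kernel over [s, t]. *)
Lemma hoelder_vconv_riesz f M : mbounded T f -> 0 <= M ->
  (forall s, 0 <= s -> s <= T -> `|f s| <= M) ->
  hoelder_on (2 * M / al) (vconv (riesz al) f).
Proof.
move=> bf M0 fM s t s0 st tT.
have t0 := le_trans s0 st; have sT := le_trans st tT.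
have kr := vkernel_riesz al0 (ltW T0).
have mr := measurable_riesz al.
have ift := vconv_integrable kr bf tT.
have ifs := vconv_integrable kr bf sT.
have mf : measurable_fun setT f by case: bf.
have mrt (c : R) : measurable_fun setT (fun r : R => riesz al (c - r)).
  by apply: (measurableT_comp mr); exact: measurable_funB.
have sub_so : `[0, s[%classic `<=` `[0, s]%classic by exact: subset_itv_co_cc.
have sub_st : `[0, s[%classic `<=` `[0, t]%classic.
  by apply: subset_itvl; rewrite bnd_simp.
have sub_r : `[s, t]%classic `<=` `[0, t]%classic.
  by apply: subset_itvr; rewrite bnd_simp.
have split_t (h : R -> R) : mu.-integrable `[0, t] (EFin \o h) ->
   \int[mu]_(r in `[0, t]) h r = \int[mu]_(r in `[0, s[) h r + \int[mu]_(r in `[s, t]) h r.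
  move=> hi; have E : `[0, t]%classic = `[0, s[%classic `|` `[s, t]%classic.
    by apply: itv_bndbnd_setU; rewrite bnd_simp.
  rewrite [in LHS]E Rintegral_setU//; first by rewrite -E.
  apply/disj_setPS => r [/=]; rewrite !in_itv/= => /andP[_ rs] /andP[sr _].
  by move: (lt_le_trans rs sr); rewrite ltxx.
have irt := vkernel_reflect_integrable kr (lexx 0) tT.
have irs := vkernel_reflect_integrable kr (lexx 0) sT.
rewrite /vconv (split_t _ ift) -[X in _ - X]Rintegral_itv_bndo_bndc; last first.
  exact: integrableS ifs.
rewrite addrAC -RintegralB//; [|exact: integrableS ift|exact: integrableS ifs].
(* The kernel vanishes by default at 0, so that r = s is excluded when the kernels
   at s - r and t - r are compared. *)
have I1 : `|\int[mu]_(r in `[0, s[) (riesz al (t - r) * f r - riesz al (s - r) * f r)| <=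
    M * (\int[mu]_(r in `[0, s[) riesz al (s - r) -
         \int[mu]_(r in `[0, s[) riesz al (t - r)).
  rewrite -RintegralB//; [|exact: integrableS irs|exact: integrableS irt].
  have idf : mu.-integrable `[0, s[
      (EFin \o (fun r => riesz al (t - r) * f r - riesz al (s - r) * f r)).
    by apply: RintegrableB => //; [exact: integrableS ift|exact: integrableS ifs].
  have idr : mu.-integrable `[0, s[ (EFin \o (fun r => riesz al (s - r) - riesz al (t - r))).
    by apply: RintegrableB => //; [exact: integrableS irs|exact: integrableS irt].
  apply: (le_trans (le_normr_Rintegral _ idf)) => //.
  rewrite -(RintegralZl _ _ idr)//; apply: le_Rintegral => //.
  - exact: integrable_norm idf.
  - exact: RintegrableZl.
  - move=> r /=; rewrite in_itv/= => /andP[r0 rs].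
    rewrite -mulrBl normrM mulrC; apply: ler_pM => //.
      by apply: fM => //; alra.
    rewrite distrC ger0_norm// subr_ge0 ler_powR_nonpos//; alra.
have I2 : `|\int[mu]_(r in `[s, t]) (riesz al (t - r) * f r)| <=
    M * \int[mu]_(r in `[s, t]) riesz al (t - r).
  have ifr : mu.-integrable `[s, t] (EFin \o (fun r => riesz al (t - r) * f r)).
    exact: integrableS ift.
  have irr : mu.-integrable `[s, t] (EFin \o (fun r => riesz al (t - r))).
    exact: integrableS irt.
  apply: (le_trans (le_normr_Rintegral _ ifr)) => //.
  rewrite -(RintegralZl _ _ irr)//; apply: le_Rintegral => //.
  - exact: integrable_norm ifr.
  - exact: RintegrableZl.
  - move=> r /=; rewrite in_itv/= => /andP[sr rt].
    rewrite normrM mulrC (ger0_norm (powR_ge0 _ _)) ler_wpM2r ?powR_ge0//.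
    by apply: fM; [exact: le_trans sr|exact: le_trans tT].
have J a b c : 0 <= a -> a <= b -> b = c ->
    \int[mu]_(r in `[a, b]) riesz al (c - r) = (b - a) `^ al / al.
  move=> a0 ab <-; have := Rintegral_reflect b a b mr; rewrite subrr => ->.
  by have [] := @riesz_integral R al (b - a) al0; rewrite ?subr_ge0.
have J1 : \int[mu]_(r in `[0, s[) riesz al (s - r) = s `^ al / al.
  rewrite Rintegral_itv_bndo_bndc; last exact: integrableS irs.
  by rewrite J// subr0.
have J2 : \int[mu]_(r in `[s, t]) riesz al (t - r) = (t - s) `^ al / al by rewrite J.
have J3 : \int[mu]_(r in `[0, s[) riesz al (t - r) = t `^ al / al - (t - s) `^ al / al.
  by have := split_t _ irt; rewrite J2 J// subr0 => ->; rewrite addrK.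
apply: (le_trans (ler_normD _ _)); apply: (le_trans (lerD I1 I2)).
rewrite J1 J2 J3 -mulrDr -!mulrA.
rewrite [leLHS](_ : _ = M * (2 * ((t - s) `^ al / al) - (t `^ al - s `^ al) / al));
  last by ring.
rewrite [leRHS](_ : _ = M * (2 * ((t - s) `^ al / al))); last by ring.
apply: ler_wpM2l => //; rewrite gerBl divr_ge0 ?(ltW al0)// subr_ge0.
by rewrite ge0_ler_powR ?nnegrE// ltW.
Qed.

(** The value of the kernel at 0 is left free: it is attained only at the
    endpoint s = t, which is negligible. *)
Lemma vconv_cst_kernel (a f : R -> R) (c t : R) : (forall u, 0 < u -> a u = c) ->
  mu.-integrable `[0, t] (EFin \o f) -> vconv a f t = c * \int[mu]_(s in `[0, t]) f s.
Proof.
move=> ac fi; have cfi := RintegrableZl c (measurable_itv `[0, t]) fi.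
have sub : `[0, t[%classic `<=` `[0, t]%classic by exact: subset_itv_co_cc.
have cfi' : mu.-integrable `[0, t[ (EFin \o (fun s => c * f s)) by exact: integrableS cfi.
have E : {in `[0, t[%classic, (fun s => c * f s) =1 (fun s => a (t - s) * f s)}.
  by move=> s; rewrite inE/= in_itv/= => /andP[s0 st]; rewrite ac// subr_gt0.
have afi : mu.-integrable `[0, t[ (EFin \o (fun s => a (t - s) * f s)).
  by apply: eq_integrable cfi' => // s st; rewrite /= E.
rewrite -(RintegralZl c _ fi)// /vconv.
rewrite -[LHS](Rintegral_itv_bndo_bndc afi) -[RHS](Rintegral_itv_bndo_bndc cfi').
by apply: eq_Rintegral => s st; rewrite E.
Qed.

(** Abel's inversion: applying the complementary kernel to a fractional integral
    gives back a primitive. *)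
Lemma vconv_riesz_inverse f t : mbounded T f -> 0 <= t -> t <= T ->
  vconv (riesz (1 - al)) (vconv (riesz al) f) t =
  beta_const al * \int[mu]_(s in `[0, t]) f s.
Proof.
move=> bf t0 tT.
have kr := vkernel_riesz al0 (ltW T0).
have kr' : vkernel T (riesz (1 - al)) by apply: vkernel_riesz; alra.
have mr := measurable_riesz al; have mr' := measurable_riesz (1 - al).
rewrite (vconvA kr' kr bf tT).
have -> : vconv (riesz (1 - al)) (riesz al) = vconv (riesz al) (riesz (1 - al)).
  by apply/funext => s; exact: vconvC.
have fi : mu.-integrable `[0, t] (EFin \o f).
  have [M _ fM] := mbounded_ge0 bf; apply: (@Rintegrable_bounded _ _ _ M) => //.
  - by rewrite lebesgue_measure_itv/=; case: ifP => // _; rewrite -EFinB ltry.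
  - by apply: measurable_funTS; case: bf.
  - by move=> s /=; rewrite in_itv/= => /andP[s0 st]; apply: fM => //; exact: le_trans tT.
exact: (vconv_cst_kernel (fun u u0 => vconv_riesz_beta al0 al1 u0) fi).
Qed.

Lemma frac_convE (b : R) f : frac_conv b f = vconv (riesz (1 - b)) f.
Proof.
apply/funext => t; apply: eq_Rintegral => s _.
by rewrite /riesz (_ : 1 - b - 1 = - b); [rewrite powRN mulrC|ring].
Qed.

(** By [vconv_riesz_inverse], [frac_conv al z] is beta_const times a primitive
    of f near any interior point, so Lebesgue's differentiation theorem
    applies. *)
Lemma derivable_frac_conv f z : mbounded T f ->
  (forall t, 0 <= t -> t <= T -> z t = vconv (riesz al) f t) ->
  {ae mu, forall t, 0 < t -> t < T -> derivable (frac_conv al z) t 1 /\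
    derive1 (frac_conv al z) t = beta_const al * f t}.
Proof.
move=> bf zE; rewrite frac_convE.
pose f0 := f \_ `[0, T].
have [M M0 fM] := mbounded_ge0 bf; have [mf _] := bf.
have mf0 : measurable_fun setT f0.
  by apply/measurable_restrict => //; exact: measurable_funTS.
have bnd_int (A : set R) (h : R -> R) : measurable A -> (mu A < +oo)%E ->
    measurable_fun A h -> (forall s, A s -> `|h s| <= M) -> mu.-integrable A (EFin \o h).
  by move=> mA fA mh hM; exact: (Rintegrable_bounded mA fA mh hM).
have itv_fin a b : (mu `[a, b] < +oo)%E.
  by rewrite lebesgue_measure_itv/=; case: ifP => // _; rewrite -EFinB ltry.
have fi : mu.-integrable `[0, T] (EFin \o f).
  apply: bnd_int => //; first exact: measurable_funTS.
  by move=> s /=; rewrite in_itv/= => /andP[s0 st]; exact: fM.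
have f0i y : mu.-integrable `[0, y] (EFin \o f0).
  apply: bnd_int => //; first exact: measurable_funTS.
  move=> s _; rewrite /f0 patchE; case: ifPn => [|_]; last by rewrite normr0.
  by rewrite inE/= in_itv/= => /andP[s0 st]; exact: fM.
have locf : locally_integrable [set: R] f0 by exact: integrable_locally.
have := FTC1 f0i locf.
apply: filterS; first exact: (ae_filter_ringOfSetsType mu).
move=> t Ht t0 tT.
have [dF F'] := Ht t0.
pose F (y : R) := \int[mu]_(s in `[0, y]) f0 s.
have nearE : \forall y \near t, vconv (riesz (1 - al)) z y = beta_const al * F y.
  near=> y.
  have y0 : 0 <= y by apply: ltW; near: y; exact: lt_nbhsr.
  have yT : y <= T by apply: ltW; near: y; exact: lt_nbhsl.
  rewrite (@eq_vconv _ _ z (vconv (riesz al) f)); last first.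
    by move=> s s0 sy; apply: zE => //; exact: le_trans yT.
  rewrite vconv_riesz_inverse//; congr (_ * _); apply: eq_Rintegral => s.
  rewrite inE/= in_itv/= => /andP[s0 sy].
  by rewrite /f0 patchE mem_set//= in_itv/= s0 (le_trans sy).
have ft : f t = f0 t by rewrite /f0 patchE mem_set//= in_itv/= !ltW.
have dF1 : is_derive t (1 : R) F (f t).
  by rewrite ft; split; [exact: dF|rewrite -derive1E; exact: F'].
have [DF1 DF2] := is_deriveZ (beta_const al) dF1.
split.
  apply: (@near_eq_derivable _ _ _ (fun y => beta_const al * F y)) => //.
  by near do apply/esym.
rewrite derive1E -[RHS]DF2; exact: near_eq_derive.
Unshelve. all: by end_near.
Qed.

End regularity.

(** * The fractional chain rule *)

Section fractional_chain_rule.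
Context {R : realType}.
Notation mu := (@lebesgue_measure R).
Context (al : R) (al0 : 0 < al) (al1 : al < 1) (T : R) (T0 : 0 < T).
Context (n : nat) (y : R -> R) (g phi : 'I_n -> R -> R) (L C : R).
Context (bdy : mbounded T y).
Context (bg : forall i, mbounded T (g i)).
Context (bphi : forall i, mbounded T (phi i)).
Context (L0 : 0 <= L).
Context (hy : hoelder_on al T L y).
Context (hg : forall i, hoelder_on al T L (g i)).
Context (y0 : y 0 = 0).

Let x i := vconv (riesz al) (phi i).
Let z t s := y s - \sum_(i < n) g i t * x i s.

Context (C0 : 0 <= C).
Context (z_ge : forall s t, 0 <= s -> s <= t -> t <= T -> z t t <= z t s).
Context (z_le : forall s t, 0 <= s -> s <= t -> t <= T ->
  z t s - z t t <= C * (t - s) `^ (2 * al)).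

Local Ltac alra := move: al0 al1 T0 => ? ? ?; lra.

Let kr : vkernel T (riesz al).
Proof. exact: vkernel_riesz al0 (ltW T0). Qed.

Let bx i : mbounded T (x i).
Proof. exact: mbounded_vconv. Qed.

Let bz t : mbounded T (z t).
Proof.
by apply: mboundedB => //; apply: mbounded_sum => i; exact: mboundedZ.
Qed.

Let z0 t : z t 0 = 0.
Proof.
rewrite /z y0 big1 ?subr0// => i _.
by rewrite /x vconv_t0// mulr0.
Qed.

Let b1 : mbounded T (cst (1 : R)) := mbounded_cst T 1.

(** The regularized Marchaud operator applied to y: as e tends to 0, formally a
    constant multiple of the fractional derivative of y. *)
Let W e t := e `^ (- al) * y t - vconv (marchaud al e) y t.
(** By [vconv_approx_delta], the same operator applied to x i. *)
Let U e i := vconv (approx_delta al e) (phi i).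
(** The defect of the chain rule for the regularized operator. *)
Let rho e t := \sum_(i < n) g i t * U e i t - W e t.

Let kq e : 0 < e -> vkernel T (marchaud al e).
Proof. exact: vkernel_marchaud. Qed.

Let kP e : 0 < e -> vkernel T (approx_delta al e).
Proof. by move=> e0; apply: vkernel_approx_delta => //; exact: ltW. Qed.

Let bW e : 0 < e -> mbounded T (W e).
Proof.
move=> e0; apply: mboundedB; first exact: mboundedZ.
by apply: mbounded_vconv => //; exact: kq.
Qed.

Let bU e i : 0 < e -> mbounded T (U e i).
Proof. by move=> e0; apply: mbounded_vconv => //; exact: kP. Qed.

Let bgU e : 0 < e -> mbounded T (fun t => \sum_(i < n) g i t * U e i t).
Proof.
by move=> e0; apply: mbounded_sum => i; apply: mboundedM => //; exact: bU.
Qed.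

Let brho e : 0 < e -> mbounded T (rho e).
Proof. by move=> e0; apply: mboundedB; [exact: bgU|exact: bW]. Qed.

(** Convolution with [riesz al] commutes with the regularized Marchaud operator
    W, and turns it into a mollification by [vconv_approx_delta]. *)
Let vconv_W e t : 0 < e -> t <= T ->
  vconv (riesz al) (W e) t = vconv (approx_delta al e) y t.
Proof.
move=> e0 tT; have kqe := kq e0.
rewrite (vconvB kr _ _ tT); [|exact: mboundedZ|exact: mbounded_vconv].
have -> := vconv_approx_delta al0 al1 e0 (ltW T0) bdy tT.
rewrite (vconvZ (e `^ (- al)) kr bdy tT); congr (_ - _).
rewrite (vconvA kr kqe bdy tT) (vconvA kqe kr bdy tT).
congr (vconv _ y t); apply/funext => s; apply: vconvC.
  exact: measurable_riesz.
exact: measurable_marchaud.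
Qed.

(** The regularized Marchaud expression of z t: linear in z t, which vanishes at
    0, and where the singular terms in e^(-al) cancel because the kernel
    [marchaud al e] has mass e^(-al) - (t + e)^(-al). *)
Let rhoE e t : 0 < e -> 0 <= t -> t <= T ->
  rho e t = (- z t t) * (t + e) `^ (- al) +
            vconv (marchaud al e) (fun s => z t s - z t t) t.
Proof.
move=> e0 t0 tT; have kqe := kq e0.
have -> : vconv (marchaud al e) (fun s => z t s - z t t) t =
    vconv (marchaud al e) (z t) t - z t t * (e `^ (- al) - (t + e) `^ (- al)).
  rewrite (@eq_vconv _ _ _ (fun s => z t s - z t t * cst 1 s)); last first.
    by move=> s _ _; rewrite mulr1.
  rewrite (vconvB kqe (bz t) _ tT); last exact: mboundedZ.
  by rewrite (vconvZ _ kqe)// (vconv_cst1 kqe)// marchaud_integral.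
have -> : vconv (marchaud al e) (z t) t =
    vconv (marchaud al e) y t - \sum_(i < n) g i t * vconv (marchaud al e) (x i) t.
  rewrite (vconvB kqe bdy _ tT); last by apply: mbounded_sum => i; exact: mboundedZ.
  congr (_ - _); rewrite (vconv_sum kqe _ tT); last by move=> i; exact: mboundedZ.
  by apply: eq_bigr => i _; rewrite (vconvZ _ kqe).
rewrite /rho.
have -> : \sum_(i < n) g i t * U e i t = e `^ (- al) * (\sum_(i < n) g i t * x i t) -
    \sum_(i < n) g i t * vconv (marchaud al e) (x i) t.
  rewrite mulr_sumr -sumrB; apply: eq_bigr => i _.
  by rewrite /U (vconv_approx_delta al0 al1 e0 (ltW T0) (bphi i) tT) -/(x i); ring.
rewrite /W /z; ring.
Qed.

Let marchaud_power_le e u : 0 < e -> 0 <= u ->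
  marchaud al e u * u `^ (2 * al) <= al * riesz al u.
Proof.
move=> e0; rewrite le_eqVlt => /predU1P[<-|u0].
  by rewrite powR0 ?mulr0 ?mulr_ge0 ?powR_ge0 ?(ltW al0)// mulf_neq0// gt_eqF.
rewrite /marchaud -mulrA ler_pM2l//.
have -> : riesz al u = u `^ (- al - 1) * u `^ (2 * al).
  rewrite -powRD; last by apply/implyP => _; rewrite gt_eqF.
  by congr (_ `^ _); ring.
rewrite ler_wpM2r ?powR_ge0// /shifted_power ler_powR_nonpos//; alra.
Qed.

Let bdz t : mbounded T (fun s => z t s - z t t).
Proof. by apply: mboundedB => //; exact: mbounded_cst. Qed.

Let rho_ge0 e t : 0 < e -> 0 <= t -> t <= T -> 0 <= rho e t.
Proof.
move=> e0 t0 tT; rewrite rhoE//; apply: addr_ge0.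
  by rewrite mulr_ge0 ?powR_ge0// oppr_ge0 -(z0 t) z_ge.
apply: Rintegral_ge0 => s /=; rewrite in_itv/= => /andP[s0 st].
by rewrite mulr_ge0 ?mulr_ge0 ?powR_ge0 ?(ltW al0)// subr_ge0 z_ge.
Qed.

Let rho_le e t : 0 < e -> 0 <= t -> t <= T -> rho e t <= 2 * C * T `^ al.
Proof.
move=> e0 t0 tT; rewrite rhoE//.
have tTal : t `^ al <= T `^ al by rewrite ge0_ler_powR ?nnegrE//; alra.
have -> : 2 * C * T `^ al = C * T `^ al + C * T `^ al by ring.
apply: lerD.
  have := z_le (lexx 0) t0 tT; rewrite z0 sub0r subr0 => zC.
  apply: (le_trans (ler_wpM2r (powR_ge0 _ _) zC)).
  rewrite -mulrA; apply: ler_wpM2l => //; apply: le_trans tTal.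
  move: t0; rewrite le_eqVlt => /predU1P[<-|t0].
    by rewrite powR0 ?mul0r ?powR_ge0// mulf_neq0// gt_eqF.
  rewrite [leRHS](_ : _ = t `^ (2 * al) * t `^ (- al)); last first.
    rewrite -powRD; last by apply/implyP => _; rewrite gt_eqF.
    by congr (_ `^ _); ring.
  rewrite ler_wpM2l ?powR_ge0// ler_powR_nonpos//; alra.
have kqe := kq e0.
have iz := vconv_integrable kqe (bdz t) tT.
have irt := vkernel_reflect_integrable kr (lexx 0) tT.
apply: (@le_trans _ _ (\int[mu]_(s in `[0, t]) (C * al * riesz al (t - s)))).
  apply: le_Rintegral => //; first exact: RintegrableZl.
  move=> s /=; rewrite in_itv/= => /andP[s0 st].
  apply: (@le_trans _ _ (marchaud al e (t - s) * (C * (t - s) `^ (2 * al)))).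
    by rewrite ler_wpM2l ?z_le// mulr_ge0 ?powR_ge0// ltW.
  rewrite mulrCA -mulrA ler_wpM2l// marchaud_power_le// subr_ge0//.
rewrite RintegralZl//.
have := Rintegral_reflect t 0 t (measurable_riesz al); rewrite subrr subr0 => ->.
have [_ ->] := riesz_integral al0 t0.
rewrite -mulrA ler_wpM2l// mulrCA divff ?mulr1// gt_eqF//.
Qed.

(** The kernels (u + e)^(-al) and (u + e)^(-al-1) grow as e decreases, while z t
    s - z t t >= 0. Monotonicity gives the pointwise limit below without
    identifying it. *)
Let rho_homo e e' t : 0 < e' -> e' <= e -> 0 <= t -> t <= T -> rho e t <= rho e' t.
Proof.
move=> e'0 ee' t0 tT; have e0 := lt_le_trans e'0 ee'.
have shift_le r u : r <= 0 -> 0 <= u -> (u + e) `^ r <= (u + e') `^ r.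
  by move=> r0 u0; apply: ler_powR_nonpos => //; lra.
rewrite (rhoE e0 t0 tT) (rhoE e'0 t0 tT); apply: lerD.
  apply: ler_wpM2l; first by rewrite oppr_ge0 -(z0 t) z_ge.
  by apply: shift_le => //; alra.
apply: le_Rintegral => //.
- exact: vconv_integrable (kq e0) (bdz t) tT.
- exact: vconv_integrable (kq e'0) (bdz t) tT.
- move=> s /=; rewrite in_itv/= => /andP[s0 st].
  apply: ler_wpM2r; first by rewrite subr_ge0 z_ge.
  rewrite /marchaud ler_pM2l//; apply: shift_le; last by rewrite subr_ge0.
  alra.
Qed.

Let rhon k t := rho (eps k) t.
Let rho0 t := limn (rhon ^~ t).

Let rhon_cvg t : 0 <= t -> t <= T -> rhon k t @[k --> \oo] --> rho0 t.
Proof.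
move=> t0 tT; apply: nondecreasing_is_cvgn.
  move=> k m km; apply: rho_homo => //; first exact: eps_gt0.
  by rewrite /eps lef_pV2 ?posrE ?ltr0n// ler_nat.
exists (2 * C * T `^ al) => _ [k _ <-].
by apply: rho_le => //; exact: eps_gt0.
Qed.

Let rho0_ge0 t : 0 <= t -> t <= T -> 0 <= rho0 t.
Proof.
move=> t0 tT; apply: limr_ge; first exact: rhon_cvg.
by apply: nearW => k; apply: rho_ge0 => //; exact: eps_gt0.
Qed.

Let rho0_le t : 0 <= t -> t <= T -> rho0 t <= 2 * C * T `^ al.
Proof.
move=> t0 tT; apply: limr_le; first exact: rhon_cvg.
by apply: nearW => k; apply: rho_le => //; exact: eps_gt0.
Qed.

Let rho0_restr := rho0 \_ `[0, T].

Let brho0 : mbounded T rho0_restr.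
Proof.
split.
  apply/measurable_restrict => //; rewrite setTI.
  apply: (@measurable_fun_cvg _ _ R _ rhon) => //.
    by move=> k; apply: measurable_funTS; have [] := brho (@eps_gt0 R k).
  by move=> t /=; rewrite in_itv/= => /andP[t0 tT]; exact: rhon_cvg.
exists (2 * C * T `^ al) => t t0 tT.
by rewrite /rho0_restr patchE mem_set/= ?in_itv/= ?t0// ger0_norm ?rho0_ge0// rho0_le.
Qed.

Let vconv_rho_cvg t : 0 <= t -> t <= T ->
  vconv (riesz al) (rhon k) t @[k --> \oo] --> vconv (riesz al) rho0_restr t.
Proof.
move=> t0 tT; have irt := vkernel_reflect_integrable kr (lexx 0) tT.
have mrt : measurable_fun setT (fun s : R => riesz al (t - s)).
  by apply: (measurableT_comp (measurable_riesz al)); exact: measurable_funB.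
apply: (@Rdominated_cvg _ _ _ _ (fun s => 2 * C * T `^ al * riesz al (t - s))) => //.
- move=> k; apply: measurable_funTS; apply: measurable_funM => //.
  by have [] := brho (@eps_gt0 R k).
- move=> s /=; rewrite in_itv/= => /andP[s0 st]; apply: cvgM; first exact: cvg_cst.
  have sT := le_trans st tT.
  by rewrite /rho0_restr patchE mem_set/= ?in_itv/= ?s0//; exact: rhon_cvg.
- exact: RintegrableZl.
- move=> k s /=; rewrite in_itv/= => /andP[s0 st]; have sT := le_trans st tT.
  rewrite normrM (ger0_norm (powR_ge0 _ _)) mulrC ler_wpM2r ?powR_ge0//.
  by rewrite ger0_norm; [apply: rho_le|apply: rho_ge0] => //; exact: eps_gt0.
Qed.

(** Commute the multiplication by g i with the mollification, then the
    mollification with the fractional integration; the latter makes g i * phi i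
    Hoelder continuous. *)
Let vconv_gU_cvg i t : 0 < t -> t <= T ->
  vconv (riesz al) (fun s => g i s * U (eps k) i s) t @[k --> \oo] -->
  beta_const al * vconv (riesz al) (fun s => g i s * phi i s) t.
Proof.
move=> t0 tT; have bgphi := mboundedM (bg i) (bphi i).
have [M M0 phiM] := mbounded_ge0 (bphi i).
have [N N0 gphiN] := mbounded_ge0 bgphi.
have kPk k := kP (@eps_gt0 R k).
pose com k s := g i s * U (eps k) i s -
  vconv (approx_delta al (eps k)) (fun s => g i s * phi i s) s.
have bcom k : mbounded T (com k).
  apply: mboundedB; last exact: mbounded_vconv.
  by apply: mboundedM => //; apply: bU; exact: eps_gt0.
have E : (fun k => vconv (riesz al) (fun s => g i s * U (eps k) i s) t) =
    (fun k => vconv (riesz al) (com k) t +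
       vconv (approx_delta al (eps k)) (vconv (riesz al) (fun s => g i s * phi i s)) t).
  apply/funext => k.
  rewrite (vconvA (kPk k) kr bgphi tT).
  have -> : vconv (approx_delta al (eps k)) (riesz al) = vconv (riesz al) (approx_delta al (eps k)).
    by apply/funext => s; apply: vconvC; [exact: measurable_approx_delta|exact: measurable_riesz].
  rewrite -(vconvA kr (kPk k) bgphi tT) -(vconvD kr (bcom k) _ tT); last exact: mbounded_vconv.
  by apply: eq_vconv => s _ _; rewrite /com subrK.
have com0 : vconv (riesz al) (com k) t @[k --> \oo] --> 0.
  apply: (@normr_le_cvg0 _ _ (fun k => L * M * delta_moment al (eps k) T *
      \int[mu]_(s in `[0, t]) riesz al s)).
    move=> k; apply: (normr_vconv_le kr (bcom k) tT) => s s0 st.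
    apply: vconv_approx_delta_commutator => //; [exact: eps_gt0|exact: le_trans tT].
  have P0 := @delta_moment_cvg0 R al al0 al1 T (ltW T0).
  have H : L * M * delta_moment al (eps k) T * (\int[mu]_(s in `[0, t]) riesz al s)
      @[k --> \oo] --> L * M * 0 * (\int[mu]_(s in `[0, t]) riesz al s).
    by apply: cvgM; [apply: cvgM; [exact: cvg_cst|exact: P0]|exact: cvg_cst].
  by move: H; rewrite mulr0 mul0r.
have main : vconv (approx_delta al (eps k)) (vconv (riesz al) (fun s => g i s * phi i s)) t
    @[k --> \oo] --> beta_const al * vconv (riesz al) (fun s => g i s * phi i s) t.
  apply: (@vconv_approx_delta_cvg _ _ al0 al1 _ T0 _ (2 * N / al)) => //.
  - exact: mbounded_vconv.
  - by rewrite divr_ge0 ?mulr_ge0 ?(ltW al0).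
  - exact: hoelder_vconv_riesz.
rewrite E; have := cvgD com0 main.
rewrite (add0r (beta_const al * vconv (riesz al) (fun s => g i s * phi i s) t)); exact.
Qed.

(** The abstract chain rule. With y = V(x) and g the gradient of V along x, the
    two hypotheses on z t s = y s - <g t, x s> say that the first-order
    remainder of V lies between 0 and C (t-s)^(2 al). *)
Theorem vconv_riesz_chain : exists psi : R -> R,
  [/\ mbounded T psi,
      forall t, 0 <= t -> t <= T -> y t = vconv (riesz al) psi t &
      forall t, 0 <= t -> t <= T -> psi t <= \sum_(i < n) g i t * phi i t].
Proof.
have B0 := beta_const_gt0 al0 al1.
have bgphi i := mboundedM (bg i) (bphi i).
have bsum : mbounded T (fun t => \sum_(i < n) g i t * phi i t) by exact: mbounded_sum.
have bres : mbounded T (fun t => (beta_const al)^-1 * rho0_restr t) by exact: mboundedZ.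
exists (fun t => \sum_(i < n) g i t * phi i t - (beta_const al)^-1 * rho0_restr t).
split; first exact: mboundedB; last first.
  move=> t t0 tT; rewrite gerBl mulr_ge0 ?invr_ge0 ?(ltW B0)//.
  by rewrite /rho0_restr patchE mem_set/= ?in_itv/= ?t0// rho0_ge0.
move=> t; rewrite le_eqVlt => /predU1P[<- _|t0 tT]; first by rewrite vconv_t0.
apply: (mulfI (lt0r_neq0 B0)).
rewrite (vconvB kr bsum bres tT) (vconvZ _ kr brho0 tT) (vconv_sum kr bgphi tT).
rewrite mulrBr mulVKf ?gt_eqF// mulr_sumr.
have lim1 : vconv (approx_delta al (eps k)) y t @[k --> \oo] --> beta_const al * y t.
  exact: (vconv_approx_delta_cvg al0 al1 T0 bdy L0 hy t0 tT).
have E : (fun k => vconv (approx_delta al (eps k)) y t) =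
  (fun k => \sum_(i < n) vconv (riesz al) (fun s => g i s * U (eps k) i s) t -
    vconv (riesz al) (rhon k) t).
  apply/funext => k; have e0 := @eps_gt0 R k.
  have bgUi i : mbounded T (fun s => g i s * U (eps k) i s).
    by apply: mboundedM => //; exact: bU.
  rewrite -(vconv_W e0 tT) -(vconv_sum kr bgUi tT) -(vconvB kr (bgU e0) (brho e0) tT).
  by apply: eq_vconv => s _ _; rewrite /rho opprB addrC subrK.
apply: (cvg_unique (@Rhausdorff R) lim1); rewrite E.
apply: cvgB; last exact: vconv_rho_cvg (ltW t0) tT.
have gU i := @vconv_gU_cvg i t t0 tT.
elim: (index_enum _) => [|i s IH].
  rewrite big_nil (_ : (fun _ => _) = cst 0); first exact: cvg_cst.
  by apply/funext => k; rewrite big_nil.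
rewrite big_cons (_ : (fun _ => _) = (fun k =>
    vconv (riesz al) (fun s => g i s * U (eps k) i s) t +
    \sum_(j <- s) vconv (riesz al) (fun s => g j s * U (eps k) j s) t)).
  by apply: cvgD.
by apply/funext => k; rewrite big_cons.
Qed.

End fractional_chain_rule.

(** * Convex functions with Lipschitz gradient *)

Section euclidean.
Context {R : realType} {n : nat}.
Implicit Types u v w : 'rV[R]_n.

Lemma edotBr u v w : edot u (v - w) = edot u v - edot u w.
Proof.
by rewrite /edot -sumrB; apply: eq_bigr => i _; rewrite !mxE mulrBr.
Qed.

Lemma edotBl u v w : edot (u - v) w = edot u w - edot v w.
Proof.
by rewrite /edot -sumrB; apply: eq_bigr => i _; rewrite !mxE mulrBl.
Qed.

Lemma edotNr u v : edot u (- v) = - edot u v.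
Proof. by rewrite /edot -sumrN; apply: eq_bigr => i _; rewrite !mxE mulrN. Qed.

Lemma enorm_ge0 u : 0 <= enorm u.
Proof. exact: sqrtr_ge0. Qed.

Lemma coord_le_enorm u (i : 'I_n) : `|u 0 i| <= enorm u.
Proof.
rewrite /enorm -sqrtr_sqr ler_wsqrtr// /edot (bigD1 i)//= expr2 lerDl.
by apply: sumr_ge0 => j _; rewrite -expr2 sqr_ge0.
Qed.

Lemma enorm_le_sum u : enorm u <= \sum_(i < n) `|u 0 i|.
Proof.
have S0 : 0 <= \sum_(i < n) `|u 0 i| by exact: sumr_ge0.
rewrite /enorm -[leRHS](ger0_norm S0) -sqrtr_sqr ler_wsqrtr//.
rewrite expr2 mulr_suml /edot; apply: ler_sum => i _.
rewrite (bigD1 i)//= mulrDr -[leLHS]addr0 lerD//.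
  by rewrite -normrM ler_norm.
by apply: mulr_ge0 => //; apply: sumr_ge0.
Qed.

(** A crude substitute for the Cauchy-Schwarz inequality, sufficient where
    constants do not matter. *)
Lemma normr_edot_le u v (K : 'I_n -> R) : (forall i, `|u 0 i| <= K i) ->
  `|edot u v| <= (\sum_(i < n) K i) * enorm v.
Proof.
move=> uK; rewrite mulr_suml (le_trans (ler_norm_sum _ _ _))//.
apply: ler_sum => i _; rewrite normrM ler_pM//; exact: coord_le_enorm.
Qed.

Lemma derive_edot (V : 'rV[R]_n -> R) u w : differentiable V u ->
  'D_w V u = edot (gradient V u) w.
Proof.
move=> dV; rewrite deriveE// [in LHS](row_sum_delta w) linear_sum.
apply: eq_bigr => i _; rewrite linearZ/= /gradient mxE deriveE//.
exact: mulrC.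
Qed.

(** By convexity the difference quotient in the direction v - u is at most V v -
    V u for every step h in ]0, 1]; let h decrease to 0. *)
Lemma convex_gradient_le (V : 'rV[R]_n -> R) u v :
  convex_function [set: 'rV[R]_n] V -> differentiable V u ->
  V u + edot (gradient V u) (v - u) <= V v.
Proof.
move=> cV dV; rewrite addrC -lerBrDr -derive_edot//.
have dd : derivable V u (v - u) by exact: diff_derivable.
have cvgr := cvg_dnbhs_at_right dd.
apply: (cvgr_to_le cvgr).
near=> h.
have h0 : 0 < h by near: h; exact: nbhs_right_gt.
have h1 : h <= 1 by near: h; exact: nbhs_right_le.
pose t := Itv01 (ltW h0) h1.
have := cV t v u (mem_setT _) (mem_setT _).
rewrite convRE /conv/= (_ : h *: v + _ = h *: (v - u) + u); last first.
  by rewrite /unstable.onem scalerBl scale1r scalerBr addrAC addrA.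
move=> cVh; rewrite /GRing.scale/= ler_pdivrMl// lerBlDr.
apply: (le_trans cVh); rewrite /unstable.onem le_eqVlt; apply/orP; left; apply/eqP.
ring.
Unshelve. all: by end_near. Qed.

(** The upper bound comes from the gradient inequality at v: the remainder is at
    most <grad V v - grad V u, v - u>, to which the Lipschitz bound applies. *)
Lemma gradient_remainder (V : 'rV[R]_n -> R) (r lam : R) u v : 
  convex_function [set: 'rV[R]_n] V ->
  (forall w, differentiable V w) ->
  (forall w w', eball r w -> eball r w' ->
    enorm (gradient V w - gradient V w') <= lam * enorm (w - w')) ->
  eball r u -> eball r v ->
  0 <= V v - V u - edot (gradient V u) (v - u) <= n%:R * lam * enorm (v - u) ^+ 2.
Proof.
move=> cV dV glip ru rv; apply/andP; split.
  by rewrite -addrA -opprD subr_ge0 convex_gradient_le.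
have h := convex_gradient_le u cV (dV v).
rewrite -(opprB v u) edotNr -lerBrDr opprK in h.
apply: (@le_trans _ _ (edot (gradient V v - gradient V u) (v - u))).
  by rewrite edotBl; lra.
apply: (le_trans (ler_norm _)).
apply: (le_trans (normr_edot_le (K := fun=> lam * enorm (v - u)) _ _)).
  by move=> i; rewrite (le_trans (coord_le_enorm _ i))// glip.
by rewrite sumr_const card_ord -[_ *+ n]mulr_natl expr2 !mulrA.
Qed.

End euclidean.

Section gamma.
Context {R : realType}.
Notation mu := (@lebesgue_measure R).

(** Positivity requires integrability, since [Rintegral] would return 0 for an
    infinite integral. The integrand is dominated by s^(a-1) on ]0, 1] and by
    exp(-s) beyond. *)
Lemma Gamma_gt0 (a : R) : 0 < a -> a < 1 -> 0 < Gamma a.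
Proof.
move=> a0 a1.
pose f (s : R) := s `^ (a - 1) * expR (- s).
have mf : measurable_fun setT f.
  apply: measurable_funM; first exact: measurable_powR.
  by apply: measurableT_comp => //; exact: measurable_funN.
have f0 s : 0 <= f s by rewrite mulr_ge0 ?powR_ge0 ?expR_ge0.
have [ri rE] := riesz_integral a0 (@ler01 R).
have fi : mu.-integrable `]0, +oo[ (EFin \o f).
  apply: (@le_Rintegrable _ _ _
    (fun s => (riesz a \_ `[0, 1]) s + exponential_pdf 1 s)) => //.
  - exact: measurable_funTS.
  - move=> s /=; rewrite in_itv/= andbT => s0; rewrite ger0_norm//.
    rewrite (exponential_pdfE _ (ltW s0)) mul1r mulN1r patchE mem_setE in_itv/= (ltW s0)/=.
    case: (leP s 1) => s1.
      have e1 : expR (- s) <= 1 by rewrite -expR0 ler_expR oppr_le0 ltW.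
      by rewrite -[leLHS]addr0 lerD ?expR_ge0// /f /riesz ler_piMr ?powR_ge0.
    rewrite add0r /f ler_piMl ?expR_ge0//.
    have a10 : a - 1 <= 0 by lra.
    by have := ler_powR_nonpos a10 ltr01 (ltW s1); rewrite powR1.
  - apply: RintegrableD => //.
      apply: (@integrableS _ _ _ mu setT) => //.
      by rewrite -restrict_EFin; apply/integrable_restrict => //=; rewrite setTI.
    apply: (@integrableS _ _ _ mu setT) => //.
    exact: integrable_exponential_pdf.
have sub : [set` `](0:R), 1]] `<=` [set` `]0, +oo[] by exact: subset_itvl.
apply: (@lt_le_trans _ _ (expR (- 1) * \int[mu]_(s in `]0, 1]) riesz a s)).
  rewrite Rintegral_itv_obnd_cbnd; last by apply: integrableS ri => //; exact: subset_itv_oc_cc.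
  by rewrite rE powR1 mul1r mulr_gt0 ?expR_gt0 ?invr_gt0.
have ri' : mu.-integrable `]0, 1] (EFin \o riesz a).
  by apply: integrableS ri => //; exact: subset_itv_oc_cc.
rewrite -RintegralZl//.
apply: (@le_trans _ _ (\int[mu]_(s in `]0, 1]) f s)).
  apply: le_Rintegral => //; [exact: RintegrableZl|exact: integrableS fi|].
  move=> s /=; rewrite in_itv/= => /andP[s0 s1].
  by rewrite /f mulrC ler_wpM2l ?powR_ge0// ler_expR lerN2.
rewrite /Gamma /Rintegral fine_le//.
- by apply: integrable_fin_num => //; exact: integrableS fi.
- exact: integrable_fin_num.
- apply: ge0_subset_integral => //.
    by apply/measurable_EFinP; exact: measurable_funTS.
  by move=> s _; rewrite lee_fin.
Qed.

End gamma.

(** * Bounded representatives *)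

Section representatives.
Context {R : realType} (T : R) (T0 : 0 < T).
Notation mu := (@lebesgue_measure R).

(** Precomposition with the projection onto [0, T] extends a function from [0,
    T] to the line and preserves Hoelder continuity, hence gives
    measurability. *)
Definition clamp (t : R) : R := Num.max 0 (Num.min T t).

Lemma clamp_ge0 t : 0 <= clamp t.
Proof. by rewrite le_max lexx. Qed.

Lemma clamp_le t : clamp t <= T.
Proof. by rewrite ge_max (ltW T0) ge_min lexx. Qed.

Lemma clamp_id t : 0 <= t -> t <= T -> clamp t = t.
Proof. by move=> t0 tT; rewrite /clamp (min_r tT) (max_r t0). Qed.

Lemma clampE t : clamp t = if t <= 0 then 0 else if T <= t then T else t.
Proof.
have [t0|t0] := leP t 0.
  by rewrite /clamp max_l// ge_min t0 orbT.
have [Tt|Tt] := leP T t; last by rewrite clamp_id// ltW.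
by rewrite /clamp (min_l Tt) max_r// ltW.
Qed.

Lemma clamp_lipschitz s t : `|clamp t - clamp s| <= `|t - s|.
Proof.
wlog st : s t / s <= t => [H|].
  by have [/H//|/ltW/H] := leP s t; rewrite distrC (distrC t).
rewrite (ger0_norm (_ : 0 <= t - s)) ?subr_ge0// ler_norml !clampE.
have T0' := T0.
by case: (leP t 0) => ?; case: (leP s 0) => ?; case: (leP T t) => ?;
  case: (leP T s) => ?; apply/andP; split; lra.
Qed.

Lemma mbounded_clamp (al L : R) (z : R -> R) : 0 < al -> 0 <= L ->
  hoelder_on al T L z -> mbounded T (z \o clamp).
Proof.
move=> al0 L0 hz.
have hzc s t : `|z (clamp t) - z (clamp s)| <= L * `|t - s| `^ al.
  wlog st : s t / clamp s <= clamp t => [H|].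
    have [/H//|/ltW/H] := leP (clamp s) (clamp t).
    by rewrite distrC (distrC t).
  rewrite (le_trans (hz _ _ (clamp_ge0 s) st (clamp_le t)))//.
  rewrite ler_wpM2l// ge0_ler_powR ?nnegrE ?subr_ge0 ?(ltW al0)//.
  by rewrite (le_trans _ (clamp_lipschitz s t))// ler_norm.
have cz : continuous (z \o clamp).
  move=> t; apply/cvgrPdist_le => e e0 /=.
  have L1 : 0 < L + 1 by rewrite ltr_wpDl.
  have d0 : 0 < (e / (L + 1)) `^ (al^-1) by apply: powR_gt0; exact: divr_gt0.
  near=> s.
  have ts : `|t - s| <= (e / (L + 1)) `^ (al^-1).
    by near: s; apply: (cvgrPdist_le id t).1 d0; exact: cvg_id.
  rewrite (le_trans (hzc _ _))//.
  apply: (@le_trans _ _ (L * ((e / (L + 1)) `^ (al^-1)) `^ al)).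
    by rewrite ler_wpM2l// ge0_ler_powR ?nnegrE ?powR_ge0 ?(ltW al0).
  rewrite -powRrM mulVf ?gt_eqF// powRr1 ?divr_ge0 ?(ltW e0) ?(ltW L1)//.
  by rewrite mulrCA ler_piMr ?(ltW e0)// ler_pdivrMr// mul1r lerDl.
split; first exact: continuous_measurable_fun.
exists (`|z 0| + L * T `^ al) => t t0 tT /=; rewrite clamp_id//.
rewrite -[z t](subrK (z 0)) addrC (le_trans (ler_normD _ _))// lerD2l.
rewrite (le_trans (hz _ _ (lexx 0) t0 tT))// subr0 ler_wpM2l//.
by rewrite ge0_ler_powR ?nnegrE ?(ltW al0) ?(ltW T0).
Unshelve. all: by end_near. Qed.

(** Truncation at an essential bound changes f on a null set only, so no
    convolution with f is affected. *)
Lemma Linfty_mbounded (f : R -> R) : Linfty T f -> exists2 f' : R -> R,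
  mbounded T f' & forall a t, measurable_fun setT a -> 0 <= t -> t <= T ->
    vconv a f t = vconv a f' t.
Proof.
move=> [mf [M fM]].
pose K := `|M|.
pose f' := (fun t => Num.max (- K) (Num.min K (f t))) \_ `[0, T].
have mclip : measurable_fun `[0, T] (fun t => Num.max (- K) (Num.min K (f t))).
  by apply: measurable_maxr => //; exact: measurable_minr.
have K0 : 0 <= K by exact: normr_ge0.
have mf' : measurable_fun setT f' by apply/(measurable_restrictT _ _).1.
exists f'.
  split => //; exists K => t _ _; rewrite /f' patchE; case: ifP => _; last by rewrite normr0.
  by rewrite ler_norml le_max lexx/= ge_max ge_min lexx/= andbT; lra.
move=> a t ma t0 tT; rewrite /vconv /Rintegral; congr fine.
have sub := @sub_itv0 R T t tT.
have mat : measurable_fun `[0, t] (fun s : R => a (t - s)).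
  by apply: measurable_funTS; apply: (measurableT_comp ma); exact: measurable_funB.
apply: ae_eq_integral => //.
- apply/measurable_EFinP; apply: measurable_funM => //.
  exact: measurable_funS mf.
- apply/measurable_EFinP; apply: measurable_funM => //.
  exact: measurable_funTS.
move: fM; apply: filterS; first exact: (ae_filter_ringOfSetsType mu).
move=> s fM st; congr (_ * _)%:E.
have sT : `[0, T]%classic s by exact: sub.
rewrite /f' patchE mem_set//.
have := fM sT; move=> fsM.
have : `|f s| <= K by rewrite (le_trans fsM)// ler_norm.
by rewrite ler_norml => /andP[Kf fK]; rewrite (min_r fK) (max_r Kf).
Qed.

Lemma mbounded_Linfty (f : R -> R) : mbounded T f -> Linfty T f.
Proof.
move=> [mf [M fM]]; split; first exact: measurable_funTS.
by exists M; apply: aeW => t /=; rewrite in_itv/= => /andP[t0 tT]; exact: fM.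
Qed.

Lemma Linfty_coord (n : nat) (phi : R -> 'rV[R]_n) (i : 'I_n) :
  Linfty_vec T phi -> Linfty T (coordf phi i).
Proof.
move=> [mphi [M phiM]]; split => //; exists M; move: phiM.
apply: filterS; first exact: (ae_filter_ringOfSetsType mu).
move=> t phiM tT; rewrite (le_trans _ (phiM tT))//.
exact: coord_le_enorm.
Qed.

End representatives.

(** * Riemann-Liouville integrals and derivatives *)

Section chain.
Context {R : realType}.
Notation mu := (@lebesgue_measure R).

(** The two endpoints are negligible; the derivatives are two-sided and only
    make sense inside. *)
Lemma ae_itv_interior (T : R) (P : R -> Prop) :
  {ae mu, forall t, 0 < t -> t < T -> P t} ->
  {ae mu, forall t, `[0, T]%classic t -> P t}.
Proof.
have ne (c : R) : {ae mu, forall t, t != c}.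
  exists [set c]; split => //; first exact: lebesgue_measure_set1.
  by move=> t /= /negP/negPn/eqP.
move=> h; apply: (@filterS3 _ _ (ae_filter_ringOfSetsType mu) _ _ _ _ _ h (ne 0) (ne T)).
move=> t Pt t0 tT /=; rewrite in_itv/= => /andP[t0' tT'].
by apply: Pt; rewrite lt_neqAle ?t0' ?tT' ?andbT// eq_sym.
Qed.

(** The normalization 1 / Gamma(alpha) is absorbed in phi. *)
Lemma RLint_coord (n : nat) (alpha T : R) (x : R -> 'rV[R]_n) :
  0 < alpha -> alpha < 1 -> 0 < T -> in_RLint_Linfty_vec alpha T x ->
  exists phi : 'I_n -> R -> R, (forall i, mbounded T (phi i)) /\
    forall i t, 0 <= t -> t <= T -> x t 0 i = vconv (riesz alpha) (phi i) t.
Proof.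
move=> a0 a1 T0 [f Lf xE].
have kr := vkernel_riesz a0 (ltW T0).
have /choice[phi phiP] : forall i, exists phi : R -> R, mbounded T phi /\
    forall t, 0 <= t -> t <= T -> x t 0 i = vconv (riesz alpha) phi t.
  move=> i; have [f' bf' ff'] := Linfty_mbounded (Linfty_coord i Lf).
  exists (fun t => (Gamma alpha)^-1 * f' t); split; first exact: mboundedZ.
  move=> t t0 tT; rewrite xE/= ?in_itv/= ?t0// mxE /RLint frac_convE subKr.
  by rewrite (vconvZ _ kr bf' tT) ff'//; exact: measurable_riesz.
by exists phi; split => i; [have [] := phiP i|have [_] := phiP i].
Qed.

Lemma RLint_of_vconv (alpha T : R) (y psi : R -> R) :
  0 < alpha -> alpha < 1 -> 0 < T -> mbounded T psi ->
  (forall t, 0 <= t -> t <= T -> y t = vconv (riesz alpha) psi t) ->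
  in_RLint_Linfty alpha T y.
Proof.
move=> a0 a1 T0 bpsi yE; have kr := vkernel_riesz a0 (ltW T0).
exists (fun t => Gamma alpha * psi t).
  by apply: mbounded_Linfty => //; exact: mboundedZ.
move=> t /=; rewrite in_itv/= => /andP[t0 tT]; rewrite yE// /RLint frac_convE subKr.
by rewrite (vconvZ _ kr bpsi tT) mulKf// gt_eqF// Gamma_gt0.
Qed.

(** Sum the Hoelder constants of the coordinates. *)
Lemma enorm_hoelder_vconv_riesz (n : nat) (alpha T : R)
  (phi : 'I_n -> R -> R) (x : R -> 'rV[R]_n) :
  0 < alpha -> alpha < 1 -> 0 < T -> (forall i, mbounded T (phi i)) ->
  (forall i t, 0 <= t -> t <= T -> x t 0 i = vconv (riesz alpha) (phi i) t) ->
  exists2 K : R, 0 <= K & forall s t, 0 <= s -> s <= t -> t <= T ->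
    enorm (x t - x s) <= K * (t - s) `^ alpha.
Proof.
move=> a0 a1 T0 bphi xE.
have /choice[L LP] : forall i, exists L : R, 0 <= L /\
    hoelder_on alpha T L (vconv (riesz alpha) (phi i)).
  move=> i; have [M M0 phiM] := mbounded_ge0 (bphi i).
  exists (2 * M / alpha); split; last exact: hoelder_vconv_riesz.
  by rewrite divr_ge0 ?mulr_ge0// ltW.
exists (\sum_(i < n) L i); first by apply: sumr_ge0 => i _; have [] := LP i.
move=> s t s0 st tT; have t0 := le_trans s0 st; have sT := le_trans st tT.
rewrite (le_trans (enorm_le_sum _))// mulr_suml.
apply: ler_sum => i _; rewrite !mxE (xE i t t0 tT) (xE i s s0 sT).
by have [_] := LP i; apply.
Qed.

End chain.

Theorem lemma3p1 (R : realType) (n : nat) (alpha T : R) (V : 'rV[R]_n -> R)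
    (x : R -> 'rV[R]_n) (y : R -> R)
    (halpha0 : 0 < alpha) (halpha1 : alpha < 1) (hT : 0 < T)
    (V1_convex : convex_function [set: 'rV[R]_n] V)
    (V1_zero : V 0 = 0)
    (V2 : forall u : 'rV[R]_n, differentiable V u)
    (V3 : forall r : R, 0 <= r -> exists2 lam : R, 0 < lam &
      forall u v : 'rV[R]_n, eball r u -> eball r v ->
        enorm (gradient V u - gradient V v) <= lam * enorm (u - v))
    (hx : in_RLint_Linfty_vec alpha T x)
    (hy : forall t : R, `[0, T]%classic t -> y t = V (x t)) :
  in_RLint_Linfty alpha T y /\
  {ae @lebesgue_measure R, forall t : R, `[0, T]%classic t ->
    [/\ RLderivable alpha y t, RLderivable_vec alpha x t &
      RLder alpha y t <= edot (gradient V (x t)) (RLder_vec alpha x t)]}.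
Proof.
have yE t : 0 <= t -> t <= T -> y t = V (x t).
  by move=> t0 tT; apply: hy; rewrite /= in_itv/= t0.
have [phi [bphi xE]] := RLint_coord halpha0 halpha1 hT hx.
have [K K0 xK] := enorm_hoelder_vconv_riesz halpha0 halpha1 hT bphi xE.
have x0 : x 0 = 0.
  by apply/rowP => i; rewrite xE ?(ltW hT)// vconv_t0// mxE.
have powT t : 0 <= t -> t <= T -> t `^ alpha <= T `^ alpha.
  by move=> t0 tT; rewrite ge0_ler_powR ?nnegrE ?(ltW halpha0) ?(ltW hT).
have xball t : 0 <= t -> t <= T -> eball (K * T `^ alpha) (x t).
  move=> t0 tT; rewrite /eball/=; have := xK 0 t (lexx 0) t0 tT.
  by rewrite x0 !subr0 => /le_trans; apply; rewrite ler_wpM2l ?powT.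
have [|lam lam0 glip] := V3 (K * T `^ alpha); first by rewrite mulr_ge0 ?powR_ge0.
pose g i t := gradient V (x t) 0 i.
have gK s t : 0 <= s -> s <= t -> t <= T ->
    enorm (gradient V (x t) - gradient V (x s)) <= lam * K * (t - s) `^ alpha.
  move=> s0 st tT; have t0 := le_trans s0 st; have sT := le_trans st tT.
  rewrite (le_trans (glip _ _ (xball t t0 tT) (xball s s0 sT)))//.
  by rewrite -mulrA ler_pM2l// xK.
have lK0 : 0 <= lam * K by rewrite mulr_ge0 ?(ltW lam0).
have hg i : hoelder_on alpha T (lam * K) (g i).
  move=> s t s0 st tT; apply: le_trans (gK s t s0 st tT).
  have -> : g i t - g i s = (gradient V (x t) - gradient V (x s)) 0 i.
    by rewrite /g [RHS]mxE [X in _ = _ + X]mxE.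
  exact: coord_le_enorm.
pose G i := `|g i 0| + lam * K * T `^ alpha.
have gG i t : 0 <= t -> t <= T -> `|g i t| <= G i.
  move=> t0 tT; rewrite -[g i t](subrK (g i 0)) addrC (le_trans (ler_normD _ _))//.
  rewrite lerD2l (le_trans (hg i 0 t (lexx 0) t0 tT))// subr0.
  by rewrite ler_wpM2l ?powT.
have rem u v := gradient_remainder V1_convex V2 glip (u := u) (v := v).
pose Ly := (\sum_(i < n) G i) * K.
have Ly0 : 0 <= Ly.
  by rewrite mulr_ge0// sumr_ge0// => i _; rewrite addr_ge0// mulr_ge0 ?powR_ge0.
have hVx : hoelder_on alpha T Ly (fun t => V (x t)).
  move=> s t s0 st tT; have t0 := le_trans s0 st; have sT := le_trans st tT.
  have bound r w : 0 <= r -> r <= T -> w = x t - x s \/ w = x s - x t ->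
      `|edot (gradient V (x r)) w| <= Ly * (t - s) `^ alpha.
    move=> r0 rT wE.
    apply: (le_trans (normr_edot_le (K := G) _ _)); first by move=> i; exact: gG.
    rewrite /Ly -mulrA ler_wpM2l//.
      by rewrite sumr_ge0// => i _; rewrite addr_ge0// mulr_ge0 ?powR_ge0.
    have -> : enorm w = enorm (x t - x s).
      case: wE => ->//; rewrite /enorm /edot; congr (Num.sqrt _).
      by apply: eq_bigr => i _; rewrite !mxE; ring.
    exact: xK.
  have /andP[r1 _] := rem _ _ (xball t t0 tT) (xball s s0 sT).
  have /andP[r2 _] := rem _ _ (xball s s0 sT) (xball t t0 tT).
  have := bound t _ t0 tT (or_intror erefl); have := bound s _ s0 sT (or_introl erefl).
  rewrite !ler_norml => /andP[b1 b2] /andP[b3 b4]; apply/andP; split; lra.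
pose L := lam * K + Ly.
have L0 : 0 <= L by exact: addr_ge0.
have hoelder_weaken L1 z : L1 <= L -> hoelder_on alpha T L1 z ->
    hoelder_on alpha T L (z \o clamp T).
  move=> L1L hz s t s0 st tT /=; rewrite !clamp_id ?(le_trans st) ?(le_trans s0)//.
  by rewrite (le_trans (hz s t s0 st tT))// ler_wpM2r ?powR_ge0.
(* The chain rule needs functions that are measurable on the whole line, while
   nothing is known about x and y outside of [0, T]. *)
pose yc := (fun t => V (x t)) \o clamp T.
pose gc i := g i \o clamp T.
pose C := n%:R * lam * K ^+ 2.
have remx s t : 0 <= s -> s <= t -> t <= T ->
  0 <= V (x s) - V (x t) - edot (gradient V (x t)) (x s - x t) <=
    C * (t - s) `^ (2 * alpha).
  move=> s0 st tT; have t0 := le_trans s0 st; have sT := le_trans st tT.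
  have /andP[-> r2] := rem _ _ (xball t t0 tT) (xball s s0 sT).
  apply: (le_trans r2).
  have -> : enorm (x s - x t) = enorm (x t - x s).
    rewrite /enorm /edot; congr (Num.sqrt _).
    by apply: eq_bigr => i _; rewrite !mxE; ring.
  have -> : C * (t - s) `^ (2 * alpha) = n%:R * lam * (K * (t - s) `^ alpha) ^+ 2.
    by rewrite /C (mulrC 2) powRrM powR_mulrn ?powR_ge0//; ring.
  apply: ler_wpM2l; first by rewrite mulr_ge0 ?(ltW lam0).
  by rewrite ler_sqr ?nnegrE ?mulr_ge0 ?enorm_ge0 ?powR_ge0// xK.
have zE s t : 0 <= s -> s <= t -> t <= T ->
   yc s - \sum_(i < n) gc i t * vconv (riesz alpha) (phi i) s -
   (yc t - \sum_(i < n) gc i t * vconv (riesz alpha) (phi i) t) =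
   V (x s) - V (x t) - edot (gradient V (x t)) (x s - x t).
  move=> s0 st tT; have t0 := le_trans s0 st; have sT := le_trans st tT.
  have sumE r : 0 <= r -> r <= T ->
      \sum_(i < n) gc i t * vconv (riesz alpha) (phi i) r = edot (gradient V (x t)) (x r).
    by move=> r0 rT; apply: eq_bigr => i _; rewrite /gc/= clamp_id// -xE.
  rewrite (sumE s s0 sT) (sumE t t0 tT) edotBr.
  have -> : yc s = V (x s) by rewrite /yc/= clamp_id.
  have -> : yc t = V (x t) by rewrite /yc/= clamp_id.
  ring.
have byc : mbounded T yc by exact: (mbounded_clamp hT halpha0 Ly0 hVx).
have bgc i : mbounded T (gc i) by exact: (mbounded_clamp hT halpha0 lK0 (hg i)).
have hyc : hoelder_on alpha T L yc by apply: (hoelder_weaken Ly) => //; rewrite lerDr.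
have hgc i : hoelder_on alpha T L (gc i).
  by apply: (hoelder_weaken (lam * K)) => //; rewrite lerDl.
have yc0 : yc 0 = 0 by rewrite /yc/= clamp_id ?(ltW hT)// x0.
have C0 : 0 <= C by rewrite !mulr_ge0 ?(ltW lam0) ?exprn_ge0.
have z_ge s t : 0 <= s -> s <= t -> t <= T ->
    yc t - \sum_(i < n) gc i t * vconv (riesz alpha) (phi i) t <=
    yc s - \sum_(i < n) gc i t * vconv (riesz alpha) (phi i) s.
  by move=> s0 st tT; rewrite -subr_ge0 zE//; have /andP[] := remx s t s0 st tT.
have z_le s t : 0 <= s -> s <= t -> t <= T ->
    yc s - \sum_(i < n) gc i t * vconv (riesz alpha) (phi i) s -
    (yc t - \sum_(i < n) gc i t * vconv (riesz alpha) (phi i) t) <=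
    C * (t - s) `^ (2 * alpha).
  by move=> s0 st tT; rewrite zE//; have /andP[] := remx s t s0 st tT.
have [psi [bpsi ycE psi_le]] := vconv_riesz_chain halpha0 halpha1 hT byc bgc bphi
  L0 hyc hgc yc0 C0 z_ge z_le.
have ypsi t : 0 <= t -> t <= T -> y t = vconv (riesz alpha) psi t.
  by move=> t0 tT; rewrite yE// -ycE// /yc/= clamp_id.
split; first exact: RLint_of_vconv bpsi ypsi.
apply: ae_itv_interior.
have Dy := derivable_frac_conv halpha0 halpha1 hT bpsi ypsi.
have Dx : {ae lebesgue_measure, forall t : R, forall i : 'I_n, 0 < t -> t < T ->
    derivable (frac_conv alpha (coordf x i)) t 1 /\
    derive1 (frac_conv alpha (coordf x i)) t = beta_const alpha * phi i t}.
  apply: (@filter_forall _ _ _ _ (ae_filter_ringOfSetsType lebesgue_measure)) => i.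
  exact: (derivable_frac_conv halpha0 halpha1 hT (bphi i) (xE i)).
apply: (@filterS2 _ _ (ae_filter_ringOfSetsType lebesgue_measure) _ _ _ _ Dy Dx).
move=> t Dyt Dxt t0 tT; have [dy y'] := Dyt t0 tT.
split; [exact: dy|by move=> i; have [] := Dxt i t0 tT|].
have G1 : 0 < Gamma (1 - alpha) by apply: Gamma_gt0; lra.
have B0 := beta_const_gt0 halpha0 halpha1.
have -> : edot (gradient V (x t)) (RLder_vec alpha x t) =
    (Gamma (1 - alpha))^-1 * (beta_const alpha * \sum_(i < n) gc i t * phi i t).
  rewrite /edot !mulr_sumr; apply: eq_bigr => i _.
  have -> : RLder_vec alpha x t 0 i = RLder alpha (coordf x i) t by rewrite mxE.
  rewrite /RLder; have [_ ->] := Dxt i t0 tT.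
  by rewrite /gc/= clamp_id ?(ltW t0) ?(ltW tT)// /g; ring.
rewrite /RLder y' ler_pM2l ?invr_gt0// ler_pM2l// psi_le// ltW//.
Qed.
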